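(* Let $\mathcal{G}$ be a finite connected graph with positive conductances $C$ and killing rates $\kappa\ge0$, transition matrix $P$, loop measure $\mu$, and let $\mathcal{L}$ be the Poisson point process of loops with intensity $\mu$. As $\gamma$ varies in the set of geodesic loops of $\mathcal{G}$ not homotopic to a point (i.e. the set of non-trivial conjugacy classes of the fundamental group), the numbers $|\{l\in\mathcal{L}:\ l^g=\gamma\}|$ are independent Poisson random variables with mean values $$\mu_\gamma=\frac{1}{\mathrm{mult}(\gamma)}\prod_{e\ \text{edge of}\ \gamma}P^{e^-}_{e^+}\,\rho^{e^-,e^+},$$ where the product runs over all the successive oriented edges $e=(e^-,e^+)$ traversed by $\gamma$, counted with the number of times they are traversed.
   Context: Graph and loops: $\mathcal{G}$ is a finite connected non-oriented graph with vertex set $X$ and edge set $E$, with no loop edges and no multiple edges. A based loop is a path $(x_0,x_1,\dots,x_{n-1},x_0)$, $n\ge1$, along edges; a loop is an equivalence class of based loops under cyclic shift. $\mathrm{mult}(l)$ is the largest integer $m$ such that a based loop representing $l$ is the concatenation of $m$ identical based loops. A geodesic loop is the class, under cyclic shift, of non-backtracking based loops which are also tailless (the first edge differs from the opposite of the last edge). Each loop $l$ is homotopic to a unique geodesic loop $l^g$ (obtained by erasing all backtracking parts); geodesic loops are in canonical bijection with conjugacy classes of the fundamental group. Markov chain and loop measure: conductances $C_{x,y}=C_{y,x}>0$ on edges ($C_{x,y}=0$ if $\{x,y\}\notin E$), killing rates $\kappa_x\ge0$, $\lambda_x=\kappa_x+\sum_yC_{x,y}$, $P^x_y=C_{x,y}/\lambda_x$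 (the chain jumps from $x$ to $y$ with probability $P^x_y$ and is killed at $x$ with probability $\kappa_x/\lambda_x$). The loop measure is $\mu(l)=\frac{1}{\mathrm{mult}(l)}\prod_{\text{edges }e\text{ of }l}P^{e^-}_{e^+}$, the product being over all edge traversals of $l$. The quantities $r^{x,y}$, $\rho^{x,y}$: for adjacent vertices $x,y$, $r^{x,y}$ is the probability that the Markov chain started at $y$ does not go to $x$ at its first step and returns to $y$ following a tree-contour subloop; precisely, it is the sum of $\prod_{k}P^{y_{k}}_{y_{k+1}}$ over all paths $(y_0=y,y_1,\dots,y_n=y)$, $n\ge1$, in $\mathcal{G}$ with $y_1\ne x$ whose lift to the universal cover of $\mathcal{G}$ returns to its starting point for the first time at time $n$. These satisfy $r^{x,y}=\sum_{z\neq x}P^y_zP^z_y\sum_{n\ge0}[r^{y,z}]^n$. Finally $\rho^{x,y}=\sum_{n=0}^\infty[r^{x,y}]^n$. *)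

(* Defs.v *)
From HB Require Import structures.
From Stdlib Require Import Relation_Operators.
From mathcomp Require Import all_boot all_order all_algebra generic_quotient.
From mathcomp Require Import all_classical all_reals all_analysis measurable_realfun.

Set Implicit Arguments.
Unset Strict Implicit.
Unset Printing Implicit Defensive.

Import Order.TTheory GRing.Theory Num.Theory.

Local Open Scope classical_set_scope.
Local Open Scope ring_scope.
Local Open Scope quotient_scope.

Section Loops.
Variables (X : finType) (E : rel X).

(* The based loop (x_0, x_1, .., x_(n-1), x_0) is stored as the sequence
   [:: x_0; ..; x_(n-1)]; [cycle] also checks the closing edge. *)
Definition based_loop := {s : seq X | (s != [::]) && cycle E s}.

Definition shift_equiv (s t : based_loop) : bool :=
  `[< exists i, rot i (val s) = val t >].

Lemma shift_equiv_refl : reflexive shift_equiv.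
Proof. by move=> s; apply/asboolP; exists 0%N; rewrite rot0. Qed.

Lemma shift_equiv_sym : symmetric shift_equiv.
Proof.
suff H (s t : based_loop) : shift_equiv s t -> shift_equiv t s.
  by move=> s t; apply/idP/idP; apply: H.
move=> /asboolP [i ist]; apply/asboolP.
by exists (size (rot i (val s)) - i)%N; rewrite -ist; exact: rotK.
Qed.

Lemma shift_equiv_trans : transitive shift_equiv.
Proof.
move=> t s u /asboolP [i ist] /asboolP [j jtu]; apply/asboolP.
by exists (rot_add (val s) i j); rewrite -rot_rot_add ist.
Qed.

Canonical shift_equiv_equiv :=
  EquivRel shift_equiv shift_equiv_refl shift_equiv_sym shift_equiv_trans.

Definition loop := {eq_quot shift_equiv}.

(* The notions below are read off the representative [repr l]; they do not
   depend on it, up to a cyclic shift for [loop_edges]. *)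
Definition loop_seq (l : loop) : seq X := val (repr l).

(* The successive oriented edges (x_0,x_1), .., (x_(n-1),x_0), repeated as many
   times as they are traversed. *)
Definition loop_edges (l : loop) : seq (X * X) :=
  zip (loop_seq l) (rot 1 (loop_seq l)).

Definition loop_mult (l : loop) : nat :=
  \max_(m < (size (loop_seq l)).+1 |
        `[< exists t : based_loop, loop_seq l = flatten (nseq m (val t)) >]) m.

(* Non-backtracking: no edge is followed by its opposite.  [cycle] also compares
   the last edge with the first one, which is the tailless condition. *)
Definition geodesic (l : loop) : bool :=
  cycle [rel a b : X * X | b != (a.2, a.1)] (loop_edges l).

(* As based loops have length at least 1, the constant loops are not of this
   type: these are the geodesic loops that are not homotopic to a point. *)
Definition geodesic_loop := {l : loop | geodesic l}.

Definition erase_backtrack (l l' : loop) : Prop :=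
  exists (s s' : based_loop) (x y : X) (t : seq X),
    [/\ val s = [:: x, y, x & t], val s' = x :: t,
        \pi_loop s = l & \pi_loop s' = l'].

Definition homotopic : loop -> loop -> Prop :=
  clos_refl_sym_trans loop erase_backtrack.

(* [None] stands for the constant loops, and is the value of [loop_geodesic] at
   the loops homotopic to a point. *)
Definition loop_geodesic (l : loop) : option geodesic_loop :=
  xget None (Some @` [set g : geodesic_loop | homotopic l (val g)]).

(* Universal cover based at y: its vertices are the non-backtracking paths from
   y, written with their endpoint first; each one is adjacent to its one-edge
   extensions, and the covering map sends a path to its endpoint. *)
Definition cover_step (p : seq X) (z : X) : seq X :=
  if p is _ :: u :: q then if z == u then u :: q else z :: p else z :: p.

(* The positions at times 1, .., n of the lift of (y, s_1, .., s_n). *)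
Definition cover_lift (y : X) (s : seq X) : seq (seq X) := scanl cover_step [:: y] s.

(* s is the path (y, s_1, .., s_n), with its starting point y omitted. *)
Definition tree_excursion (x y : X) (s : seq X) : bool :=
  [&& path E y s, s != [::], head y s != x &
      (index [:: y] (cover_lift y s)).+1 == size s].

End Loops.

Section Chain.
Variables (R : realType) (X : finType) (E : rel X).
Variables (C : X -> X -> R) (kappa : X -> R).

Definition total_rate (x : X) : R := kappa x + \sum_(y : X) C x y.

Definition trans_prob (x y : X) : R := C x y / total_rate x.

Definition loop_measure (l : loop E) : R :=
  (loop_mult l)%:R^-1 * \prod_(a <- loop_edges l) trans_prob a.1 a.2.

Definition path_weight (y : X) (s : seq X) : R :=
  \prod_(a <- zip (belast y s) s) trans_prob a.1 a.2.

Local Open Scope ereal_scope.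

Definition excursion_weight (x y : X) : \bar R :=
  \esum_(s in [set s | tree_excursion E x y s]) (path_weight y s)%:E.

Definition rho (x y : X) : \bar R :=
  \sum_(0 <= n <oo) excursion_weight x y ^+ n.

Definition geodesic_mean (g : loop E) : \bar R :=
  ((loop_mult g)%:R^-1)%:E *
  \prod_(a <- loop_edges g) ((trans_prob a.1 a.2)%:E * rho a.1 a.2).

End Chain.

Section Poisson.
Local Open Scope ereal_scope.
Context {d : measure_display} {Omega : measurableType d} {R : realType}.
Variable Pr : probability Omega R.

Definition independent_variables (I : choiceType) (Y : I -> Omega -> \bar R) :=
  (forall i, measurable_fun [set: Omega] (Y i)) /\
  forall (s : seq I) (B : I -> set (\bar R)),
    uniq s -> (forall i, measurable (B i)) ->
    Pr (\bigcap_(i in [set` s]) (Y i @^-1` B i)) =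
    \prod_(i <- s) Pr (Y i @^-1` B i).

(* Poisson law of mean m, with the usual convention that it is the Dirac mass
   at +oo for m = +oo.  The second argument of [poisson_prob] is a dummy. *)
Definition poisson_variable (Y : Omega -> \bar R) (m : \bar R) : Prop :=
  match m with
  | r%:E => (0 <= r)%R /\
      forall k : nat, Pr [set w | Y w = k%:R%:E] = poisson_prob r 0 [set k]
  | +oo => Pr [set w | Y w = +oo] = 1
  | -oo => False
  end.

(* A random multiset of points of T is given by the multiplicities N t w. *)
Definition point_count (T : choiceType) (N : T -> Omega -> nat) (A : set T)
    (w : Omega) : \bar R :=
  \esum_(t in A) (N t w)%:R%:E.

(* Poisson point process on a discrete space T, whose intensity gives the mass
   mu t to the point t. *)
Definition poisson_point_process (T : choiceType) (mu : T -> R)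
    (N : T -> Omega -> nat) : Prop :=
  [/\ forall t, measurable_fun [set: Omega] (N t),
      forall A : set T,
        poisson_variable (point_count N A) (\esum_(t in A) (mu t)%:E) &
      forall (n : nat) (A : 'I_n -> set T), trivIset [set: 'I_n] A ->
        independent_variables (fun i => point_count N (A i))].

End Poisson.

(* Main.v *)
Require Import Defs.
From Stdlib Require Import Relation_Operators.
From mathcomp Require Import all_boot all_order all_algebra generic_quotient.
From mathcomp Require Import zify.
From mathcomp Require Import all_classical all_reals all_analysis.

(* Count, among the rotations of a based loop s of length n, those whose lift to
   the universal cover starts with a last exit: it never comes back to its
   starting point, and ends at the endpoint of the lift of a fixed based
   representative of the geodesic loop gamma.  Erasing a backtrack of s does not
   change this number, which is mult gamma for gamma itself; so it is mult gamma
   for every loop homotopic to gamma, and 0 for the other loops.  Since a loop l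
   has n / mult l based representatives, the measure of the loops homotopic to
   gamma is 1 / mult gamma times the weight of the based loops of this kind.

   Cutting such a based loop at the last exits from the successive vertices of
   the lift of gamma writes it uniquely as the edges of gamma, each edge (x, y)
   being followed by a sequence of excursions at y that avoid x in the cover:
   this is the factor P x y * rho x y.  The excursions at y form a prefix-free
   set of paths whose first step is not x, so their total weight is at most
   1 - P y x < 1 and rho is finite. *)

Set Implicit Arguments.
Unset Strict Implicit.
Unset Printing Implicit Defensive.

Import Order.TTheory GRing.Theory Num.Theory.

Local Open Scope classical_set_scope.
Local Open Scope ring_scope.
Local Open Scope quotient_scope.

(** * Sequences and their rotations *)

Section Sequences.
Local Open Scope nat_scope.
Variable T : eqType.
Implicit Types (a : pred T) (s t u : seq T).

Lemma eqseq_cat2r s t u : (t ++ s == u ++ s) = (t == u).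
Proof.
apply/eqP/eqP => [e|-> //].
have tu : size t = size u.
  by have /eqP := congr1 size e; rewrite !size_cat eqn_add2r => /eqP.
by have /eqP := e; rewrite eqseq_cat // => /andP[/eqP].
Qed.

Lemma cat_eq_prefix s s' t t' : s ++ t = s' ++ t' -> size s <= size s' ->
  prefix s s'.
Proof.
by move=> e ss'; rewrite prefixE -(takel_cat t' ss') -e take_size_cat.
Qed.

Definition prefix_free (A : set (seq T)) : Prop :=
  forall s t, A s -> A t -> prefix s t -> s = t.

Lemma prefix_free_cat_inj (A B : set (seq T)) : prefix_free A ->
  set_inj (A `*` B) (fun ab => ab.1 ++ ab.2).
Proof.
move=> pfA [s t] [s' t'] /set_mem[/= As _] /set_mem[/= As' _] e.
have ss' : s = s'.
  have [le|/ltnW le] := leqP (size s) (size s').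
    by apply: pfA => //; exact: cat_eq_prefix e le.
  by apply/esym/pfA => //; exact: cat_eq_prefix (esym e) le.
by move: e; rewrite ss' => /eqP; rewrite eqseq_cat // eqxx => /eqP ->.
Qed.

Definition uncons (z : T) s : option (seq T) :=
  if s is a :: s' then if a == z then Some s' else None else None.

Lemma mem_pmap_uncons z (S : seq (seq T)) s :
  (s \in pmap (uncons z) S) = (z :: s \in S).
Proof.
apply: can2_mem_pmap => [[|a t]|t] /=; rewrite ?eqxx //.
by case: eqP => //= ->.
Qed.

Lemma uniq_pmap_uncons z (S : seq (seq T)) : uniq S -> uniq (pmap (uncons z) S).
Proof.
by apply: (pmap_uniq (g := cons z)) => -[|a t] //=; case: eqP => //= ->.
Qed.

Lemma prefix_free_uncons z (S : seq (seq T)) :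
  prefix_free [set` S] -> prefix_free [set` pmap (uncons z) S].
Proof.
move=> pf s t; rewrite /= !mem_pmap_uncons => zs zt st.
by have := pf _ _ zs zt; rewrite /= eqxx => /(_ st)[].
Qed.

Lemma count_unique a s : uniq s -> {in s &, forall x y, a x -> a y -> x = y} ->
  count a s = has a s.
Proof.
elim: s => //= x s IH /andP[xs us] inj; rewrite IH //; last first.
  by move=> y z ys zs; apply: inj; rewrite inE ?ys ?zs orbT.
case ax: (a x) => //=; congr S; apply/eqP; rewrite eqb0; apply/hasPn => y ys.
apply: contra xs => ay.
by rewrite (inj x y) ?inE ?eqxx ?ys ?orbT.
Qed.

Lemma index_rcons_eq (x y : T) s :
  (index x (rcons s y) == size s) = (x \notin s) && (y == x).
Proof.
rewrite -cats1 index_cat; case: ifPn => [xs|xs] /=.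
  by rewrite ltn_eqF ?index_mem.
by case: (y == x); rewrite ?addn0 ?eqxx // -[X in _ == X]addn0 eqn_add2l.
Qed.

Lemma zip_rot (U V : Type) i (s : seq U) (t : seq V) : size s = size t ->
  zip (rot i s) (rot i t) = rot i (zip s t).
Proof.
move=> st; rewrite /rot zip_cat ?size_drop ?st //.
congr (_ ++ _); elim: s t i st => [|x s IH] [|y t] [|i] //= [/IH] //.
by move->.
Qed.

(* An empty sequence has no rotation in this list. *)
Definition rots s : seq (seq T) := mkseq (rot^~ s) (size s).

Lemma rots_rot k s : perm_eq (rots (rot k s)) (rots s).
Proof.
have [sk|/ltnW] := leqP (size s) k; first by rewrite rot_oversize.
elim: k => [|k IH] ks; first by rewrite rot0.
apply: perm_trans (IH (ltnW ks)); rewrite -add1n rotD //.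
case: (rot k s) => // x t; set u := x :: t.
have un : size u = (size t).+1 by [].
have -> : rots (rot 1 u) = rcons [seq rot i u | i <- iota (1 + 0) (size t)] u.
  rewrite /rots size_rot un mkseqS -rotD ?un addn1 // -un rot_size; congr rcons.
  rewrite iotaDl -map_comp; apply/eq_in_map => i.
  rewrite mem_iota => /andP[_ it].
  by rewrite -rotD ?un addn1 // ltnW.
by rewrite perm_rcons /rots /mkseq /= rot0.
Qed.

Lemma count_rotsD (P : pred (seq T)) m n s : size s = m + n ->
  count P (rots s) = count P [seq rot i s | i <- iota 0 m] +
                     count (fun i => P (rot (m + i) s)) (iota 0 n).
Proof.
move=> sn; rewrite /rots /mkseq sn iotaD map_cat count_cat; congr (_ + _).
by rewrite -[0 + m in LHS]addnC iotaDl -map_comp count_map.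
Qed.

Lemma mem_rots s t : s != [::] ->
  reflect (exists i, rot i s = t) (t \in rots s).
Proof.
move=> s0; apply: (iffP mapP) => [[i _ ->]|[i <-]]; first by exists i.
have [si|lt_is] := leqP (size s) i; last by exists i => //; rewrite mem_iota.
by exists 0; rewrite ?rot0 ?rot_oversize // mem_iota lt0n size_eq0.
Qed.

Lemma count_mem_rots_rot k s :
  count_mem (rot k s) (rots s) = count_mem s (rots s).
Proof.
rewrite -(permP (rots_rot k s)) /rots /mkseq !count_map size_rot.
by apply: eq_count => i /=; rewrite rot_rot (inj_eq (@rot_inj k T)).
Qed.

Lemma size_flatten_nseq m u : size (flatten (nseq m u)) = m * size u.
Proof. by elim: m => //= m IH; rewrite size_cat IH. Qed.

Lemma rot_flatten_nseq m u :
  rot (size u) (flatten (nseq m u)) = flatten (nseq m u).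
Proof.
case: m => [|m]; first by rewrite /rot.
by rewrite rot_size_cat; elim: m => [|m IH] /=; rewrite ?cats0 // -catA IH.
Qed.

Lemma commute_flatten_nseq k u v : u ++ v = v ++ u -> size v = k * size u ->
  v = flatten (nseq k u).
Proof.
elim: k v => [|k IH] v uv sv; first exact: size0nil.
have /prefixP[w ew] : prefix u v.
  by apply: cat_eq_prefix uv _; rewrite sv leq_addr.
rewrite ew /=; congr (_ ++ _); apply: IH.
  by move: uv; rewrite ew -catA => /eqP; rewrite eqseq_cat // => /andP[_ /eqP].
by move: sv; rewrite ew size_cat mulSn => /addnI.
Qed.

Lemma rot_fixed_flatten d s : rot d s = s -> 0 < d -> d %| size s ->
  s = flatten (nseq (size s %/ d) (take d s)).
Proof.
move=> ds d0 /dvdnP[k sk]; have std : size (take d s) = minn d (size s).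
  exact: size_take_min.
rewrite sk mulnK //; apply: commute_flatten_nseq.
  by rewrite -{2}ds /rot catA cat_take_drop.
by rewrite std sk; case: (k) => // j; rewrite (minn_idPl _) ?leq_pmull.
Qed.

Lemma rot_period s : s != [::] -> exists d, [/\ 0 < d, d %| size s &
  forall i, i <= size s -> (rot i s == s) = (d %| i)].
Proof.
move=> s0; have fixed_gt0 : exists d, (0 < d) && (rot d s == s).
  by exists (size s); rewrite rot_size eqxx andbT lt0n size_eq0.
have [d /andP[d0 /eqP ds] dmin] := ex_minnP fixed_gt0.
have rot_mul k : k * d <= size s -> rot (k * d) s = s.
  elim: k => [|k IH]; first by rewrite rot0.
  by rewrite mulSn => kd; rewrite rotD // IH // (leq_trans _ kd) ?leq_addl.
have rotE i : i <= size s -> (rot i s == s) = (d %| i).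
  move=> le_is; apply/eqP/dvdnP => [|[k ek]]; last by rewrite ek rot_mul // -ek.
  rewrite {1}(divn_eq i d) addnC rotD; last by rewrite addnC -divn_eq.
  rewrite rot_mul ?(leq_trans (leq_divM _ _)) // => rot_mod; exists (i %/ d).
  have := dmin (i %% d); rewrite rot_mod eqxx andbT.
  case: posnP => [mod0 _|_ /(_ isT)]; last by rewrite leqNgt ltn_mod d0.
  by rewrite {1}(divn_eq i d) mod0 addn0.
by exists d; split; rewrite // -rotE // rot_size.
Qed.

Lemma count_dvdn d k : 0 < d -> count (dvdn d) (iota 0 (k * d)) = k.
Proof.
case: d => // d _; elim: k => // k IH.
rewrite mulSnr iotaD count_cat IH add0n -[k * _]addn0 iotaDl count_map.
rewrite -[RHS]addn1; congr (_ + _).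
rewrite /= dvdn_addr ?dvdn_mull //= -[RHS]addn0; congr (_ + _).
apply/eqP; rewrite eqn0Ngt -has_count; apply/hasPn => i.
rewrite mem_iota => /andP[i_gt0 i_lt].
by rewrite /= dvdn_addr ?dvdn_mull // gtnNdvd.
Qed.

Lemma count_mem_rots_maxP s (k := count_mem s (rots s)) : s != [::] ->
  (exists u, s = flatten (nseq k u)) /\
  forall m u, s = flatten (nseq m u) -> m <= k.
Proof.
move=> s0; have [d [d0 ds rotE]] := rot_period s0.
have -> : k = size s %/ d.
  rewrite -(count_dvdn (size s %/ d) d0) divnK // /k /rots /mkseq count_map.
  apply: eq_in_count => i; rewrite mem_iota => /andP[_ lt_is] /=.
  by rewrite rotE //; exact: ltnW.
split=> [|m u su].
  exists (take d s); apply: rot_fixed_flatten => //.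
  by apply/eqP; rewrite rotE // dvdn_leq // lt0n size_eq0.
case: (posnP m) => [-> //|m0].
have sm : size s = m * size u by rewrite su size_flatten_nseq.
have u0 : 0 < size u.
  by move: s0; rewrite -size_eq0 sm -lt0n muln_gt0 => /andP[].
have du : d %| size u.
  by rewrite -rotE; [rewrite su rot_flatten_nseq | rewrite sm leq_pmull].
by rewrite leq_divRL // sm leq_mul2l dvdn_leq ?orbT.
Qed.

End Sequences.

(** * Lifts to the universal cover *)

Section CoverLift.
Local Open Scope nat_scope.
Variable X : finType.
Implicit Types (x y z : X) (p q r b c s t : seq X).

Fixpoint reduced p : bool :=
  match p with
  | a :: ((b :: c :: _) as p') => (a != c) && reduced p'
  | _ => true
  end.

Lemma reducedP p :
  reflect (forall c x y r, p <> c ++ [:: x, y, x & r]) (reduced p).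
Proof.
elim: p => [|a p IH]; first by apply: ReflectT => - [].
apply: (iffP idP) => [red [|b c] x y r|nred].
- by move=> e; move: red; rewrite e /= eqxx.
- move=> [_ ep]; have redp : reduced p.
    by case: (p) red => [|? [|? ?]] //= /andP[].
  by have /IH/(_ c x y r) := redp.
have /IH red : forall c x y r, p <> c ++ [:: x, y, x & r].
  by move=> c x y r ep; apply: (nred (a :: c) x y r); rewrite ep.
case: p red nred {IH} => [|b [|c p]] // red nred; apply/andP; split=> //.
by apply/eqP => ac; apply: (nred [::] a b p); rewrite ac.
Qed.

Lemma reduced_rev p : reduced (rev p) = reduced p.
Proof.
suff rev_red q : reduced q -> reduced (rev q).
  by apply/idP/idP => /rev_red; rewrite ?revK.
move=> /reducedP red; apply/reducedP => c x y r eq.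
apply: (red (rev r) x y (rev c)).
by rewrite -[q]revK eq rev_cat !rev_cons -!cats1 -!catA.
Qed.

Lemma reduced_catl p q : reduced (p ++ q) -> reduced p.
Proof.
move=> /reducedP red; apply/reducedP => c x y r ep.
by apply: (red c x y (r ++ q)); rewrite ep -catA.
Qed.

Lemma cover_step_head p z : exists r, cover_step p z = z :: r.
Proof.
case: p => [|a [|u r]] /=; [by exists [::] | by exists [:: a] |].
by case: eqP => [->|_]; [exists r | exists [:: a, u & r]].
Qed.

Lemma cover_stepP p z : cover_step p z = z :: p \/
  exists a r, p = [:: a, z & r] /\ cover_step p z = z :: r.
Proof.
case: p => [|a [|u r]] /=; [by left | by left |].
by case: eqP => [->|_]; [right; exists a, r | left].
Qed.

Lemma cover_step_up p z : size p < size (cover_step p z) ->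
  cover_step p z = z :: p.
Proof. by case: p => [|a [|u r]] //=; case: eqP => //= _; lia. Qed.

Lemma size_cover_step_le p z : size (cover_step p z) <= (size p).+1.
Proof. by case: p => [|a [|u r]] //=; case: eqP => //= _; lia. Qed.

Lemma size_cover_step_ge p z : size p <= (size (cover_step p z)).+1.
Proof. by case: p => [|a [|u r]] //=; case: eqP => //= _; lia. Qed.

Lemma size_cover_step_gt1 x p y : p != [::] ->
  (1 < size (cover_step (x :: p) y)) = (x :: p != [:: x; y]).
Proof.
case: p => [//|u r] _ /=; rewrite !eqseq_cons eqxx /= (eq_sym u).
by case: (y == u) => //=; case: r.
Qed.

Lemma reduced_cons z p :
  reduced (z :: p) = reduced p && (cover_step p z == z :: p).
Proof.
case: p => [|a [|u r]]; rewrite ?eqxx //= andbC; congr (_ && _).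
case: eqVneq => [_|_]; last by rewrite eqxx.
by apply/esym/eqP => /(congr1 size) /=; lia.
Qed.

Lemma cover_step_reduced p z : reduced p -> reduced (cover_step p z).
Proof.
case: p => [|a [|u r]] //=; case: eqVneq => [_|zu red].
  by case: r => // v r /andP[].
by rewrite /= zu.
Qed.

Lemma cover_stepK x p y : reduced (x :: p) ->
  cover_step (cover_step (x :: p) y) x = x :: p.
Proof.
rewrite reduced_cons => /andP[_ /eqP].
case: p => [|u r] up; first by rewrite /= eqxx.
by rewrite {2}/cover_step; case: eqP => _; rewrite // /cover_step eqxx.
Qed.

Lemma cover_step_cat p b z : 1 < size p ->
  cover_step (p ++ b) z = cover_step p z ++ b.
Proof. by case: p => [|a [|u r]] //= _; case: eqP. Qed.

Definition lift_end p c : seq X := foldl (@cover_step X) p c.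

Definition lift_path p c : seq (seq X) := scanl (@cover_step X) p c.

(* The starting point [p] is not tested. *)
Definition above h p c : bool := all (fun r => h < size r) (lift_path p c).

Definition lifts_above h p c q : bool := (lift_end p c == q) && above h p c.

Lemma lift_end_cons p z c : lift_end p (z :: c) = lift_end (cover_step p z) c.
Proof. by []. Qed.

Lemma lift_end_cat p c1 c2 :
  lift_end p (c1 ++ c2) = lift_end (lift_end p c1) c2.
Proof. exact: foldl_cat. Qed.

Lemma lift_end_rcons p c z :
  lift_end p (rcons c z) = cover_step (lift_end p c) z.
Proof. exact: foldl_rcons. Qed.

Lemma lift_path_cat p c1 c2 :
  lift_path p (c1 ++ c2) = lift_path p c1 ++ lift_path (lift_end p c1) c2.
Proof. exact: scanl_cat. Qed.

Lemma lift_path_rcons p c z :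
  lift_path p (rcons c z) = rcons (lift_path p c) (lift_end p (rcons c z)).
Proof. exact: scanl_rcons. Qed.

Lemma above_cons h p z c : above h p (z :: c) =
  (h < size (cover_step p z)) && above h (cover_step p z) c.
Proof. by []. Qed.

Lemma above_cat h p c1 c2 :
  above h p (c1 ++ c2) = above h p c1 && above h (lift_end p c1) c2.
Proof. by rewrite /above lift_path_cat all_cat. Qed.

Lemma above_rcons h p c z :
  above h p (rcons c z) = above h p c && (h < size (lift_end p (rcons c z))).
Proof. by rewrite /above lift_path_rcons all_rcons andbC. Qed.

Lemma lifts_above_nil h p q : lifts_above h p [::] q = (p == q).
Proof. exact: andbT. Qed.

Lemma lifts_above_cons h p z c q : lifts_above h p (z :: c) q =
  (h < size (cover_step p z)) && lifts_above h (cover_step p z) c q.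
Proof. by rewrite /lifts_above above_cons andbCA. Qed.

Lemma lifts_above_cat h p c1 c2 q : lifts_above h p (c1 ++ c2) q =
  above h p c1 && lifts_above h (lift_end p c1) c2 q.
Proof. by rewrite /lifts_above above_cat lift_end_cat andbCA. Qed.

Lemma lifts_above_rcons h p c z q : lifts_above h p (rcons c z) q =
  [&& cover_step (lift_end p c) z == q, h < size q & above h p c].
Proof.
rewrite /lifts_above above_rcons lift_end_rcons.
by case: eqP => //= ->; rewrite andbC.
Qed.

Lemma above_le h k p c : k <= h -> above h p c -> above k p c.
Proof. by move=> kh; apply: sub_all => r; apply: leq_ltn_trans. Qed.

Lemma above_end h p c : h < size p -> above h p c -> h < size (lift_end p c).
Proof.
case/lastP: c => [|c z] // _.
by rewrite above_rcons => /andP[].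
Qed.

Lemma above0 p c : above 0 p c.
Proof.
elim: c p => // z c IH p; rewrite above_cons IH.
by have [r ->] := cover_step_head p z.
Qed.

Lemma lift_end_rcons_head p c z : exists r, lift_end p (rcons c z) = z :: r.
Proof. by rewrite lift_end_rcons; exact: cover_step_head. Qed.

Lemma lift_end_head x p c : exists r, lift_end (x :: p) c = last x c :: r.
Proof.
case/lastP: c => [|c z]; first by exists p.
by rewrite last_rcons; exact: lift_end_rcons_head.
Qed.

Lemma lift_end_reduced p c : reduced p -> reduced (lift_end p c).
Proof. by elim: c p => //= z c IH p red; apply/IH/cover_step_reduced. Qed.

(* The vertices [x :: b] at the bottom of a path cannot change before the path
   has come down to [b]. *)
Lemma above_bottom p x b c : above (size b) (p ++ x :: b) c ->
  exists r, lift_end (p ++ x :: b) c = r ++ x :: b.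
Proof.
elim: c p => [|z c IH] p; first by exists p.
rewrite above_cons lift_end_cons => /andP[up ab].
suff [r er] : exists r, cover_step (p ++ x :: b) z = r ++ x :: b.
  by move: ab; rewrite er; apply: IH.
case: p up {ab} => [|a [|u p]] /=.
- case: b {IH} => [|v b] /=; first by exists [:: z].
  by case: eqP => _ /=; [lia | exists [:: z]].
- by case: eqP => _ _; [exists [::] | exists [:: z; a]].
- by case: eqP => _ _; [exists (u :: p) | exists [:: z, a, u & p]].
Qed.

Lemma lift_end_bottom p x c : exists r, lift_end (rcons p x) c = rcons r x.
Proof.
rewrite -cats1; have [r ->] := @above_bottom p x [::] c (above0 _ _).
by exists r; rewrite cats1.
Qed.

Lemma aboveS x b c : above (size b) (x :: b) c ->
  above (size b).+1 (x :: b) c = (x :: b \notin lift_path (x :: b) c).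
Proof.
elim/last_ind: c => // c z IH ab; have [r er] := @above_bottom [::] x b _ ab.
rewrite above_rcons lift_path_rcons mem_rcons inE negb_or er andbC.
rewrite IH; last by move: ab; rewrite above_rcons => /andP[].
congr (_ && _); rewrite -[in RHS](cat0s (x :: b)) eqseq_cat2r size_cat /=.
by case: r {er} => [|a r]; rewrite ?ltnn //= addSn ltnS leq_addl.
Qed.

Lemma above_cat_base b h p c : 0 < h -> h < size p ->
  above (h + size b) (p ++ b) c = above h p c.
Proof.
move=> h0; elim: c p => // z c IH p hp.
rewrite !above_cons cover_step_cat ?(leq_ltn_trans h0) // size_cat ltn_add2r.
by case: leqP => // hz; rewrite IH.
Qed.

Lemma lift_end_cat_base b p c : 1 < size p -> above 1 p c ->
  lift_end (p ++ b) c = lift_end p c ++ b.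
Proof.
elim: c p => // z c IH p p1; rewrite above_cons => /andP[z1 ab].
by rewrite !lift_end_cons cover_step_cat // IH.
Qed.

Lemma lifts_above_cat_base b p c q : 1 < size p ->
  lifts_above (size b).+1 (p ++ b) c (q ++ b) = lifts_above 1 p c q.
Proof.
move=> p1; rewrite /lifts_above -add1n above_cat_base //.
by case ab: (above 1 p c); rewrite ?andbF // lift_end_cat_base // eqseq_cat2r.
Qed.

Lemma lifts_above_rev q b : b != [::] -> reduced (q ++ b) ->
  lifts_above (size b) b (rev q) (q ++ b).
Proof.
move=> b0; elim: q => [|z q IH]; first by rewrite /lifts_above eqxx.
rewrite cat_cons reduced_cons rev_cons lifts_above_rcons.
move=> /andP[/IH/andP[/eqP -> ->] ->].
by rewrite /= size_cat ltnS leq_addl.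
Qed.

(** * Last exits *)

Lemma exit_first p z c x q : size p = size q ->
  lifts_above (size q) p (z :: c) (x :: q) ->
  [/\ z = x, p = q & cover_step q x = x :: q].
Proof.
move=> pq; rewrite -pq lifts_above_cons => /and3P[/cover_step_up up].
rewrite up => /eqP e ab; have [r] := @above_bottom [::] z p c ab.
rewrite [_ ++ _]/= e => er; have r0 : size r = 0.
  by have := congr1 size er; rewrite size_cat /= pq; lia.
by case: r r0 er => // _ [-> ->].
Qed.

Lemma last_exit h p c : size p <= h -> h < size (lift_end p c) ->
  exists c1 z c2, [/\ c = c1 ++ z :: c2, size (lift_end p c1) = h &
    above h (lift_end p c1) (z :: c2)].
Proof.
move=> ph; elim/last_ind: c => [|c w IH]; first by rewrite ltnNge ph.
move=> hcw; have [down|/IH] := leqP (size (lift_end p c)) h.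
  exists c, w, [::]; rewrite cats1 above_cons -lift_end_rcons hcw; split=> //.
  apply/eqP; rewrite eqn_leq down -ltnS (leq_trans hcw) //.
  by rewrite lift_end_rcons size_cover_step_le.
move=> [c1 [z [c2 [ec sh ab]]]]; exists c1, z, (rcons c2 w).
rewrite -!rcons_cons -rcons_cat -ec above_rcons ab -lift_end_cat.
by rewrite -rcons_cat -ec hcw.
Qed.

Lemma last_exitP h p x q c : h <= size q -> size p <= size q -> reflect
  (exists c1 c2, [/\ c = c1 ++ x :: c2, lifts_above h p c1 q &
                     lifts_above (size q) q (x :: c2) (x :: q)])
  (lifts_above h p c (x :: q)).
Proof.
move=> hq pq.
apply: (iffP idP) => [|[c1 [c2 [-> /andP[/eqP endc1 ab1] ex]]]]; last first.
  rewrite lifts_above_cat ab1 endc1 /lifts_above.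
  by case/andP: ex => -> /(above_le hq).
case/andP=> /eqP endc ab.
have [|c1 [z [c2 [ec sz ab2]]]] := last_exit pq (c := c); first by rewrite endc.
have ex : lifts_above (size q) (lift_end p c1) (z :: c2) (x :: q).
  by rewrite /lifts_above ab2 -lift_end_cat -ec endc eqxx.
have [zx endc1 _] := exit_first sz ex; rewrite zx endc1 in ec ex.
exists c1, c2; split=> //.
by move: ab; rewrite /lifts_above ec above_cat endc1 eqxx => /andP[].
Qed.

Lemma last_exit_unique h p c1 c2 c1' c2' : c1 ++ c2 = c1' ++ c2' ->
  size (lift_end p c1) <= h -> size (lift_end p c1') <= h ->
  above h (lift_end p c1) c2 -> above h (lift_end p c1') c2' ->
  c1 = c1'.
Proof.
elim: c1 c1' p => [|a c1 IH] [|a' c1'] p //= [].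
- move=> -> _ ph'; rewrite above_cons above_cat => /and3P[up ab _] _.
  by have := above_end up ab; rewrite ltnNge ph'.
- move=> <- ph _ _; rewrite above_cons above_cat => /and3P[up ab _].
  by have := above_end up ab; rewrite ltnNge ph.
- by move=> -> e ph ph' ab ab'; rewrite (IH _ _ e ph ph' ab ab').
Qed.

Lemma exit_lift y b x c : cover_step (y :: b) x = [:: x, y & b] ->
  lifts_above (size b).+1 (y :: b) (x :: c) [:: x, y & b] =
  lifts_above 1 [:: x; y] c [:: x; y].
Proof.
move=> up; rewrite lifts_above_cons up ltnSn.
exact: (@lifts_above_cat_base b [:: x; y] c [:: x; y]).
Qed.

End CoverLift.

(** * Insertion of a backtrack *)

Section Unfolding.
Local Open Scope nat_scope.
Variable X : finType.
Implicit Types (x y z : X) (p q r b c s t : seq X).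

(* The cyclic sequence [s], closed up into a path from its first vertex, lifts
   to a path of the universal cover that ends at [q] and never comes back to its
   starting point. *)
Definition unfolds q s : bool :=
  if s is y :: s' then lifts_above 1 [:: y] (rcons s' y) q else false.

Definition nb_unfolds q s : nat := count (unfolds q) (rots s).

(* If [q] is the endpoint of the lift of a closed path, this says that a second
   lap can start from [q] without backtracking. *)
Definition tailless q : Prop :=
  2 < size q /\ forall r x y, q = r ++ [:: x; y] -> cover_step q x = x :: q.

Lemma nb_unfolds_rot q k s : nb_unfolds q (rot k s) = nb_unfolds q s.
Proof. exact/permP/rots_rot. Qed.

Lemma unfolds_backtrack q a t1 x y t2 :
  unfolds q (a :: t1 ++ [:: x, y, x & t2]) =
  unfolds q (a :: t1 ++ x :: t2) && (lift_end [:: a] (rcons t1 x) != [:: x; y]).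
Proof.
rewrite /unfolds !rcons_cat !rcons_cons -!(cat_rcons x t1) !lifts_above_cat.
have [r er] := lift_end_rcons_head [:: a] t1 x.
case ab: (above 1 [:: a] (rcons t1 x)) => //=.
have r1 : 1 < size (x :: r) by move: ab; rewrite above_rcons er => /andP[].
have red : reduced (x :: r) by rewrite -er; apply: lift_end_reduced.
rewrite er !lifts_above_cons cover_stepK // size_cover_step_gt1 ?r1 1?andbC //.
by case: (r) r1.
Qed.

Lemma unfolds_tail q x t y : 2 < size q ->
  unfolds q (x :: t ++ [:: x; y]) = unfolds q (x :: t).
Proof.
move=> q2.
rewrite /unfolds rcons_cat rcons_cons -(cat_rcons x t) lifts_above_cat.
have [r er] := lift_end_rcons_head [:: x] t x.
have red : reduced (x :: r) by rewrite -er; apply: lift_end_reduced.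
rewrite er !lifts_above_cons cover_stepK // lifts_above_nil.
rewrite [RHS]/lifts_above er andbC.
have [e|] := eqVneq (x :: r) q; last by rewrite !andbF.
have := size_cover_step_ge (x :: r) y; rewrite e => /(leq_trans q2) y1.
by rewrite (y1 : 1 < size (cover_step q y)) (ltnW q2).
Qed.

Definition returns_to x y t i : bool :=
  if drop i t is a :: t2 then lift_end [:: a] (rcons t2 x) == [:: x; y]
  else false.

(* The rotation of [x :: t] that starts at position [i] of [t] loses its last
   exit when [y; x] is inserted after [x], because the inserted [y] lifts to the
   starting point.  The rotation of [:: x, y, x & t] that starts at [y] makes up
   for this loss. *)
Definition pivot q x y t i : bool :=
  returns_to x y t i && unfolds q (rot i.+1 (x :: t)).

Definition pivot_split q x y t1 t2 : bool :=
  lifts_above 1 [:: x; y] (rcons t1 y) q &&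
  lifts_above 1 [:: y] (rcons t2 x) [:: x; y].

Lemma unfolds_rot_backtrack q x y t i : i < size t ->
  unfolds q (rot i.+3 [:: x, y, x & t]) =
  ~~ returns_to x y t i && unfolds q (rot i.+1 (x :: t)).
Proof.
move=> it; rewrite /returns_to /rot /= andbC.
case dt: (drop i t) => [|a t2]; last by rewrite !cat_cons unfolds_backtrack.
by move: it; rewrite -subn_gt0 -size_drop dt.
Qed.

Lemma pivotP q x y t i : i < size t -> reflect
  (exists t1 t2, [/\ t = t1 ++ y :: t2, size t1 = i & pivot_split q x y t1 t2])
  (pivot q x y t i).
Proof.
have unfoldsE a t1 t2 : unfolds q (a :: t2 ++ x :: t1) =
    above 1 [:: a] (rcons t2 x) &&
    lifts_above 1 (lift_end [:: a] (rcons t2 x)) (rcons t1 a) q.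
  by rewrite /unfolds rcons_cat rcons_cons -cat_rcons lifts_above_cat.
move=> it; rewrite /pivot /returns_to /rot /=; apply: (iffP idP); last first.
  move=> [t1 [t2 [-> <- /and3P[fwd /eqP ret ab]]]].
  rewrite drop_size_cat // take_size_cat // cat_cons unfoldsE.
  by rewrite ret ab eqxx fwd.
case dt: (drop i t) => [//|a t2]; rewrite cat_cons unfoldsE.
case/and3P=> /eqP ret ab fwd; rewrite ret in fwd.
have ya : y = a.
  have [r] := lift_end_bottom [::] a (rcons t2 x).
  by rewrite ret -[[:: x; y]]/(rcons [:: x] y) => /rcons_inj[].
rewrite ya in ret fwd *; exists (take i t), t2; split.
- by rewrite -dt cat_take_drop.
- by rewrite size_takel // ltnW.
- by rewrite /pivot_split fwd /lifts_above ret eqxx.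
Qed.

Lemma exit_lift_tailless q x y t1 t2 : tailless q ->
  lifts_above 1 [:: x; y] (rcons t1 y) q ->
  lifts_above (size q) q (rcons t2 x) (x :: q) =
  lifts_above 1 [:: y] (rcons t2 x) [:: x; y].
Proof.
move=> [q2 lap] /andP[/eqP e ab].
have [q' eq'] := lift_end_rcons_head [:: x; y] t1 y; rewrite e in eq'.
have [r er] := @above_bottom _ [::] x [:: y] (rcons t1 y) ab.
have up : cover_step q x = x :: q by apply: (lap r x y); rewrite -er -e.
case: (rcons t2 x) => [|z c].
  by rewrite !lifts_above_nil; apply/eqP/eqP => /(congr1 size) //=; lia.
have [->|zx] := eqVneq z x.
  by rewrite [RHS]lifts_above_cons; rewrite eq' in up *; exact: exit_lift.
have no_exit p : lifts_above (size p) p (z :: c) (x :: p) = false.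
  by apply/negP => /(exit_first erefl)[e1]; rewrite e1 eqxx in zx.
by rewrite no_exit (no_exit [:: y]).
Qed.

Lemma unfolds_inserted_lift q x y t : tailless q ->
  unfolds q [:: y, x & rcons t x] ->
  lifts_above 1 [:: x; y] (rcons t x) (x :: q).
Proof.
move=> [_ lap] us; have {us} /andP[/eqP eq ab] :
  lifts_above 1 [:: x; y] (rcons (rcons t x) y) q by exact: us.
have [r er] := @above_bottom _ [::] x [:: y] _ ab.
have up : cover_step q x = x :: q by apply: (lap r x y); rewrite -er -eq.
have [p ep] := lift_end_rcons_head [:: x; y] t x.
have et : lift_end [:: x; y] (rcons t x) = x :: q.
  rewrite -up -eq [in RHS]lift_end_rcons ep cover_stepK //.
  by rewrite -ep lift_end_reduced.
by rewrite /lifts_above et eqxx; move: ab; rewrite above_rcons => /andP[].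
Qed.

Lemma unfolds_insertedP q x y t : tailless q -> reflect
  (exists t1 t2, t = t1 ++ y :: t2 /\ pivot_split q x y t1 t2)
  (unfolds q [:: y, x & rcons t x]).
Proof.
move=> tq; have [q2 _] := tq.
apply: (iffP idP) => [us|[t1 [t2 [-> /andP[fwd]]]]]; last first.
  rewrite -(exit_lift_tailless _ tq fwd) => /andP[/eqP ret up].
  have /andP[/eqP eq ab] := fwd.
  have [q' eq'] := lift_end_rcons_head [:: x; y] t1 y; rewrite eq in eq'.
  suff : lifts_above 1 [:: x; y] (rcons t1 y ++ rcons (rcons t2 x) y) q.
    by rewrite cat_rcons -!rcons_cons -!rcons_cat.
  rewrite lifts_above_cat ab eq lifts_above_rcons ret (ltnW q2).
  by rewrite (above_le (ltnW (ltnW q2)) up) eq' /= eqxx /= eqxx.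
have [q' eq'] : exists q', q = y :: q'.
  have /andP[/eqP <- _] :
    lifts_above 1 [:: x; y] (rcons (rcons t x) y) q by exact: us.
  exact: lift_end_rcons_head.
have /last_exitP := unfolds_inserted_lift tq us.
case=> [||c1 [c2 [ec fwd ex]]]; [exact: ltnW (ltnW q2) | exact: ltnW | ].
case/lastP: c1 ec fwd => [|t1 a] ec fwd.
  by move: fwd q2; rewrite lifts_above_nil => /eqP <-.
have ya : a = y.
  have /andP[/eqP] := fwd; rewrite eq'.
  by have [s ->] := lift_end_rcons_head [:: x; y] t1 a => -[].
have [t2 et2] : exists t2, x :: c2 = rcons t2 x.
  exists (belast x c2); rewrite lastI; congr rcons.
  by have := congr1 (last x) ec; rewrite last_rcons last_cat.
rewrite et2 {}ya in ec fwd ex *; exists t1, t2; split.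
  by move: ec; rewrite -rcons_cat => /rcons_inj[->]; rewrite cat_rcons.
by rewrite /pivot_split fwd -(exit_lift_tailless _ tq fwd).
Qed.

Lemma pivot_split_unique q x y t1 t2 t1' t2' : tailless q ->
  t1 ++ y :: t2 = t1' ++ y :: t2' ->
  pivot_split q x y t1 t2 -> pivot_split q x y t1' t2' -> t1 = t1'.
Proof.
move=> tq et /andP[fwd] + /andP[fwd'].
rewrite -(exit_lift_tailless _ tq fwd) -(exit_lift_tailless _ tq fwd').
move=> /andP[_ ab] /andP[_ ab'].
case/andP: fwd fwd' => /eqP eq _ /andP[/eqP eq' _].
suff /rcons_inj[->] : rcons t1 y = rcons t1' y by [].
apply: (@last_exit_unique _ (size q) [:: x; y] _ (rcons t2 x) _ (rcons t2' x));
  rewrite ?eq ?eq' //.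
by rewrite -!rcons_cat !cat_rcons et.
Qed.

Lemma count_pivot q x y t : tailless q ->
  count (pivot q x y t) (iota 0 (size t)) = unfolds q [:: y, x & rcons t x].
Proof.
move=> tq; rewrite count_unique ?iota_uniq //; last first.
  move=> i j; rewrite !mem_iota => /andP[_ it] /andP[_ jt].
  move=> /(pivotP _ _ _ it)[t1 [t2 [et <- spl]]].
  move=> /(pivotP _ _ _ jt)[t1' [t2' [et' <- spl']]].
  by rewrite (pivot_split_unique tq _ spl spl') -?et.
congr nat_of_bool.
apply/hasP/(unfolds_insertedP _ _ _ tq) => [[i]|[t1 [t2 [et spl]]]].
  rewrite mem_iota => /andP[_ it] /(pivotP _ _ _ it)[t1 [t2 [et _ spl]]].
  by exists t1, t2.
have it : size t1 < size t by rewrite et size_cat /= -addn1 leq_add2l.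
by exists (size t1); [rewrite mem_iota | apply/pivotP => //; exists t1, t2].
Qed.

Lemma nb_unfolds_backtrack q x y t : tailless q ->
  nb_unfolds q [:: x, y, x & t] = nb_unfolds q (x :: t).
Proof.
move=> tq; have [q2 _] := tq; rewrite /nb_unfolds.
rewrite (@count_rotsD _ _ 3 (size t)) // (@count_rotsD _ _ 1 (size t)) //.
have -> : [seq rot i (x :: t) | i <- iota 0 1] = [:: x :: t] by rewrite /= rot0.
have -> : [seq rot i [:: x, y, x & t] | i <- iota 0 3] =
    [:: [:: x, y, x & t]; [:: y, x & rcons t x]; x :: t ++ [:: x; y]].
  by rewrite /= rot0 rot1_cons.
rewrite -[count _ [:: _; _; _]]/(_ + (_ + (_ + 0))) -[count _ [:: _]]/(_ + 0).
have -> : unfolds q [:: x, y, x & t] = false.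
  rewrite /unfolds !rcons_cons lifts_above_cons lifts_above_cons.
  by rewrite /= eqxx.
rewrite unfolds_tail // -count_pivot // add0n !addn0 addnAC addnC.
congr (_ + _); rewrite -[RHS]size_filter -(count_predC (returns_to x y t)).
rewrite !count_filter; congr (_ + _).
apply: eq_in_count => i; rewrite mem_iota => /andP[_ it].
exact: unfolds_rot_backtrack.
Qed.

End Unfolding.

(** * Geodesic loops *)

Section Geodesic.
Local Open Scope nat_scope.
Variable X : finType.
Implicit Types (x y z : X) (p q b c s t : seq X).

(* The endpoint of the lift of [s], closed up into a path, when [s] is
   geodesic. *)
Definition closed_end s : seq X := if s is y :: _ then y :: rev s else [::].

Definition geodesic_seq s : bool :=
  cycle [rel a b : X * X | b != (a.2, a.1)] (zip s (rot 1 s)).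

Lemma closed_end_inj : injective closed_end.
Proof. by move=> [|x s] [|y t] //= [_] /(can_inj revK). Qed.

Lemma geodesic_seq_rot i s : geodesic_seq (rot i s) = geodesic_seq s.
Proof.
by rewrite /geodesic_seq rot_rot zip_rot ?size_rot // rot_cycle.
Qed.

Lemma path_reduced x y c :
  path [rel a b : X * X | b != (a.2, a.1)] (x, y) (zip (belast y c) c) =
  reduced [:: x, y & c].
Proof.
elim: c x y => // z c IH x y; rewrite /= in IH *; rewrite IH.
by rewrite xpair_eqE eqxx /= eq_sym.
Qed.

Lemma geodesic_seqE x y s :
  geodesic_seq [:: x, y & s] = reduced ([:: x, y & s] ++ [:: x; y]).
Proof.
rewrite /geodesic_seq -[_ ++ _]/[:: x, y & s ++ [:: x; y]] -path_reduced.
rewrite /= -[[:: x; y]]/(rcons [:: x] y) -rcons_cat cats1 belast_rcons.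
by rewrite -zip_rcons ?size_rcons // rcons_cons.
Qed.

Lemma geodesic_reduced y s : 0 < size s -> geodesic_seq (y :: s) ->
  reduced (y :: rcons s y).
Proof.
case: s => [//|z s] _; rewrite geodesic_seqE => red.
by apply: (@reduced_catl _ _ [:: z]); rewrite /= cat_rcons.
Qed.

Lemma unfolds_geodesic s t : 1 < size s -> geodesic_seq s ->
  unfolds (closed_end t) s = (s == t).
Proof.
case: s => [//|y s] s1 /(geodesic_reduced s1) red.
have /andP[/eqP e ab] : lifts_above 1 [:: y] (rcons s y) (closed_end (y :: s)).
  have := @lifts_above_rev _ (rev (rcons s y)) [:: y] isT.
  rewrite revK cats1 -rev_cons reduced_rev => /(_ red).
  by rewrite -rcons_cons rev_rcons.
by rewrite /unfolds /lifts_above e ab andbT (inj_eq closed_end_inj).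
Qed.

Lemma geodesic_tailless s : 1 < size s -> geodesic_seq s ->
  tailless (closed_end s).
Proof.
case: s => [//|x [//|y s]] _; rewrite geodesic_seqE => red.
split=> [|r x' y' e]; first by rewrite /= size_rev.
have [ex ey] : x' = y /\ y' = x.
  have := congr1 rev e; rewrite /= rev_cons revK rev_cat => - [-> ->].
  by [].
rewrite ex; move: red; rewrite -[_ ++ _]/([:: x, y & s] ++ rcons [:: x] y).
rewrite -reduced_rev -rcons_cat rev_rcons reduced_cons => /andP[_ /eqP].
by rewrite cats1 rev_rcons.
Qed.

End Geodesic.

Section Loops.
Local Open Scope nat_scope.
Variables (X : finType) (E : rel X).
Implicit Types (x y z : X) (p c t u v : seq X).
Implicit Types (s g : based_loop E) (l : loop E).

Definition BasedLoop u (uP : (u != [::]) && cycle E u) : based_loop E :=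
  exist _ u uP.

Lemma pi_rot i s s' : rot i (val s) = val s' ->
  \pi_(loop E) s = \pi_(loop E) s'.
Proof. by move=> e; apply/eqmodP/asboolP; exists i. Qed.

Lemma loop_seq_pi s : exists i, loop_seq (\pi_(loop E) s) = rot i (val s).
Proof.
set l := \pi_(loop E) s.
have /eqmodP/asboolP[i e] : \pi_(loop E) s = \pi_(loop E) (repr l).
  by rewrite reprK.
by exists i.
Qed.

Lemma loop_seqP l : (loop_seq l != [::]) && cycle E (loop_seq l).
Proof. exact: (valP (repr l)). Qed.

Lemma loop_seq_neq0 l : loop_seq l != [::].
Proof. by case/andP: (loop_seqP l). Qed.

Lemma loop_size_gt1 l : irreflexive E -> 1 < size (loop_seq l).
Proof.
move=> irr; have /andP[] := loop_seqP l.
by case: (loop_seq l) => [//|x [|//]] /=; rewrite irr.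
Qed.

Lemma mem_rots_loop l t : reflect
  (exists2 s : based_loop E, val s = t & \pi_(loop E) s = l)
  (t \in rots (loop_seq l)).
Proof.
apply: (iffP idP) => [/(mem_rots _ (loop_seq_neq0 l))[k et]|[s <- <-]].
  have tP : (t != [::]) && cycle E t.
    by rewrite -et rot_cycle -size_eq0 size_rot size_eq0 loop_seqP.
  by exists (BasedLoop tP) => //; rewrite -[l]reprK; apply/esym/(@pi_rot k).
have [i ->] := loop_seq_pi s; rewrite (perm_mem (rots_rot i _)).
by apply/mem_rots; [case/andP: (valP s) | exists 0; rewrite rot0].
Qed.

Lemma cycle_flatten_nseq m u : u != [::] -> 0 < m ->
  cycle E (flatten (nseq m u)) -> cycle E u.
Proof.
case: u m => // x u [//|[|m]] _ _ /=; first by rewrite cats0.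
by rewrite rcons_cat cat_path /= => /and3P[p1 p2 _]; rewrite rcons_path p1.
Qed.

Lemma loop_multE l : loop_mult l = count_mem (loop_seq l) (rots (loop_seq l)).
Proof.
have /andP[s0 cs] := loop_seqP l.
have [[u su] max_mult] := count_mem_rots_maxP s0.
rewrite /loop_mult; move: (loop_seq l) s0 cs u su max_mult => s s0 cs u.
set k := count_mem s (rots s) => su max_mult.
have [u0 k0] : u != [::] /\ 0 < k.
  split; last by rewrite lt0n; apply: contra s0 => /eqP k0; rewrite su k0.
  apply: contra s0 => /eqP u0.
  by rewrite -size_eq0 su u0 size_flatten_nseq muln0.
apply/eqP; rewrite eqn_leq; apply/andP; split.
  by apply/bigmax_leqP => m /asboolP[t]; exact: max_mult.
have ks : k < (size s).+1.
  by rewrite ltnS (leq_trans (count_size _ _)) // size_mkseq.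
have uP : (u != [::]) && cycle E u.
  by rewrite u0 (cycle_flatten_nseq u0 k0) // -su.
apply: (@leq_bigmax_cond _ _ (fun m : 'I_(size s).+1 => m : nat) (Ordinal ks)).
by apply/asboolP; exists (BasedLoop uP).
Qed.

Lemma loop_mult_gt0 l : 0 < loop_mult l.
Proof.
rewrite loop_multE -has_count has_pred1.
by apply/mem_rots; [exact: loop_seq_neq0 | exists 0; rewrite rot0].
Qed.

Lemma nb_unfolds_homotopic q l l' : tailless q -> homotopic l l' ->
  nb_unfolds q (loop_seq l) = nb_unfolds q (loop_seq l').
Proof.
move=> tq; elim => {l l'} [l l' | // | l l' _ -> // | l l' l'' _ -> _ -> //].
move=> [s [s' [x [y [t [es es' <- <-]]]]]].
have [i ->] := loop_seq_pi s; have [j ->] := loop_seq_pi s'.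
by rewrite !nb_unfolds_rot es es' nb_unfolds_backtrack.
Qed.

Lemma homotopic_erase i j s s' x y t : rot i (val s) = [:: x, y, x & t] ->
  rot j (val s') = x :: t -> homotopic (\pi_(loop E) s) (\pi_(loop E) s').
Proof.
move=> es es'; apply: rst_step.
have sP : ([:: x, y, x & t] != [::]) && cycle E [:: x, y, x & t].
  by rewrite -[in cycle _ _]es rot_cycle; case/andP: (valP s).
have s'P : (x :: t != [::]) && cycle E (x :: t).
  by rewrite -[in cycle _ _]es' rot_cycle; case/andP: (valP s').
exists (BasedLoop sP), (BasedLoop s'P), x, y, t; split=> //.
  exact/esym/(@pi_rot i).
exact/esym/(@pi_rot j).
Qed.

Lemma homotopic_erase_backtrack s x y u v : val s = u ++ [:: x, y, x & v] ->
  exists2 s' : based_loop E, val s' = u ++ x :: v &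
  homotopic (\pi_(loop E) s) (\pi_(loop E) s').
Proof.
move=> es; have cs : cycle E ([:: x, y, x & v] ++ u).
  by rewrite cycle_catC -es; case/andP: (valP s).
have s'P : (u ++ x :: v != [::]) && cycle E (u ++ x :: v).
  rewrite cycle_catC (_ : cycle E _); last by move: cs; rewrite /= => /and3P[].
  by case: (u).
exists (BasedLoop s'P) => //.
apply: (@homotopic_erase (size u) (size u) _ _ x y (v ++ u));
  by rewrite ?es rot_size_cat.
Qed.

Lemma last_step_homotopic s g p y : val s = rev p ->
  cover_step p y = closed_end (val g) ->
  homotopic (\pi_(loop E) s) (\pi_(loop E) g).
Proof.
have [y' [t eg]] : exists y' t, val g = y' :: t.
  by case/andP: (valP g); case: (val g) => // y' t _ _; exists y', t.
case: (cover_stepP p y) => [->|[a [r [-> ->]]]] es; rewrite {1}eg => -[yy' er].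
  suff -> : s = g by exact: rst_refl.
  by apply: val_inj; rewrite es er -eg revK.
apply: (@homotopic_erase (size (val g)) 0 s g y a t).
  have -> : val s = val g ++ [:: y; a].
    by rewrite es !rev_cons er -eg revK -cats1 -cats1 -catA.
  by rewrite rot_size_cat eg yy'.
by rewrite rot0 eg yy'.
Qed.

(* [p] is the position of the lift of [s] after some steps, and the backtracks
   among these steps have been erased from [s]. *)
Lemma lift_homotopic s g p y c : val s = rev p ++ c ->
  lift_end p (rcons c y) = closed_end (val g) ->
  homotopic (\pi_(loop E) s) (\pi_(loop E) g).
Proof.
elim: c s p => [|z c IH] s p es.
  by rewrite cats0 in es; exact: last_step_homotopic.
rewrite rcons_cons lift_end_cons.
case: (cover_stepP p z) => [up|[a [r [ep ->]]]] eg.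
  by apply: (IH s (z :: p)); rewrite -?eg ?up // es rev_cons cat_rcons.
have [s' es' hom] : exists2 s' : based_loop E, val s' = rev r ++ z :: c &
    homotopic (\pi_(loop E) s) (\pi_(loop E) s').
  apply: (@homotopic_erase_backtrack _ z a).
  by rewrite es ep !rev_cons -!cats1 -!catA.
apply: rst_trans hom _; apply: (IH s' (z :: r)) => //.
by rewrite es' rev_cons cat_rcons.
Qed.

Lemma unfolds_homotopic s g : unfolds (closed_end (val g)) (val s) ->
  homotopic (\pi_(loop E) s) (\pi_(loop E) g).
Proof.
case es: (val s) => [//|y c] /andP[/eqP eg _].
exact: (@lift_homotopic s g [:: y] y c).
Qed.

End Loops.

Section GeodesicLoops.
Local Open Scope nat_scope.
Variables (X : finType) (E : rel X).
Hypothesis E_irr : irreflexive E.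
Implicit Types (s : based_loop E) (l : loop E) (g : geodesic_loop E).

Definition geodesic_end g : seq X := closed_end (loop_seq (val g)).

Lemma unfolds_geodesic_end g g' k :
  unfolds (geodesic_end g) (rot k (loop_seq (val g'))) =
  (rot k (loop_seq (val g')) == loop_seq (val g)).
Proof.
apply: unfolds_geodesic; first by rewrite size_rot loop_size_gt1.
by rewrite geodesic_seq_rot; exact: valP g'.
Qed.

Lemma nb_unfolds_geodesic g l : homotopic l (val g) ->
  nb_unfolds (geodesic_end g) (loop_seq l) = loop_mult (val g).
Proof.
have tq := geodesic_tailless (loop_size_gt1 (val g) E_irr) (valP g).
move=> /(nb_unfolds_homotopic tq) ->; rewrite loop_multE.
apply: eq_in_count => t /(mem_rots _ (loop_seq_neq0 _))[k <-].
exact: unfolds_geodesic_end.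
Qed.

Lemma homotopic_geodesic_inj g g' : homotopic (val g') (val g) -> g' = g.
Proof.
move=> /nb_unfolds_geodesic nbE; apply: val_inj.
have : 0 < nb_unfolds (geodesic_end g) (loop_seq (val g')).
  by rewrite nbE loop_mult_gt0.
rewrite -has_count => /hasP[t /(mem_rots _ (loop_seq_neq0 _))[k <-]].
rewrite unfolds_geodesic_end => /eqP e.
by rewrite -[LHS]reprK -[RHS]reprK; apply: (pi_rot e).
Qed.

Lemma loop_geodesicP g l : loop_geodesic l = Some g <-> homotopic l (val g).
Proof.
rewrite /loop_geodesic; split; first by case: xgetP => // _ _ [g' hom <-] [<-].
move=> hom; case: xgetP => [og _ [g' hom' <-]|no_geodesic].
  congr Some; apply: homotopic_geodesic_inj.
  by apply: rst_trans hom; exact: rst_sym.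
by have [] := no_geodesic (Some g); exists g.
Qed.

Lemma unfolds_loop_geodesic g s : unfolds (geodesic_end g) (val s) ->
  loop_geodesic (\pi_(loop E) s) = Some g.
Proof.
move=> us; apply/loop_geodesicP; rewrite -[val g]reprK.
exact: unfolds_homotopic.
Qed.

Lemma nb_unfoldsE g l : nb_unfolds (geodesic_end g) (loop_seq l) =
  if loop_geodesic l == Some g then loop_mult (val g) else 0.
Proof.
case: eqP => [/loop_geodesicP/nb_unfolds_geodesic //|not_g].
apply/eqP; rewrite eqn0Ngt -has_count; apply/hasPn => t.
move=> /mem_rots_loop[s <- sl]; apply/negP => /unfolds_loop_geodesic.
by rewrite sl.
Qed.

End GeodesicLoops.

(** * Sums of weights *)

Section Esum.
Local Open Scope ereal_scope.
Variable R : realType.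

Lemma ge0_esumZl (T : choiceType) (A : set T) (f : T -> \bar R) (k : R) :
  (0 <= k)%R -> (forall i, 0 <= f i) ->
  \esum_(i in A) (k%:E * f i) = k%:E * \esum_(i in A) f i.
Proof.
move=> k0 f0; rewrite /esum -ereal_supZl //; last first.
  apply/set0P; exists 0; exists set0; first exact: fsets_set0.
  by rewrite fsbig_set0.
congr ereal_sup; apply/seteqP; split => x /=.
  move=> [F AF <-]; exists (\sum_(i \in F) f i); first by exists F.
  by rewrite ge0_mule_fsumr.
move=> [_ [F AF <-] <-]; exists F => //.
by rewrite ge0_mule_fsumr.
Qed.

Lemma esum_image_mul (S T U : choiceType) (A : set S) (B : set T)
    (h : S * T -> U) (f : U -> R) (fa : S -> R) (fb : T -> R) :
  (forall a, 0 <= fa a)%R -> (forall b, 0 <= fb b)%R ->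
  set_inj (A `*` B) h ->
  (forall a b, A a -> B b -> f (h (a, b)) = (fa a * fb b)%R) ->
  \esum_(b in B) (fb b)%:E \is a fin_num ->
  \esum_(u in h @` (A `*` B)) (f u)%:E =
  (\esum_(a in A) (fa a)%:E) * (\esum_(b in B) (fb b)%:E).
Proof.
move=> fa0 fb0 inj fM fin; rewrite esum_image //.
rewrite (eq_esum (b := fun k : S * T => (fa k.1)%:E * (fb k.2)%:E)); last first.
  by move=> [a b] [/= Aa Bb]; rewrite fM // EFinM.
rewrite -(@esum_esum _ _ _ A (fun=> B) (fun a b => (fa a)%:E * (fb b)%:E));
  last by move=> a b _ _; rewrite mule_ge0 // lee_fin.
under eq_esum do rewrite ge0_esumZl //.
rewrite -(fineK fin) [RHS]muleC -ge0_esumZl //.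
  by apply: eq_esum => a _; rewrite muleC.
by rewrite fine_ge0 // esum_ge0 // => b _; rewrite lee_fin.
Qed.

(* [esum_bigcupT] is the case [I = nat]. *)
Lemma esum_bigcup_trivIset (I T : choiceType) (K : set I) (J : I -> set T)
    (f : T -> \bar R) :
  trivIset [set: I] J -> (forall t, 0 <= f t) ->
  \esum_(t in \bigcup_(i in K) J i) f t = \esum_(i in K) \esum_(t in J i) f t.
Proof.
move=> tJ f0; rewrite esum_esum //; apply: reindex_esum; split.
- by move=> [i t] [/= Ki Jt]; exists i.
- move=> [i t] [i' t'] /set_mem[/= Ki Jt] /set_mem[/= Ki' Jt'] e.
  rewrite -e in Jt' *; congr pair; apply: (tJ i i') => //.
  by exists t.
- by move=> t [i Ki Jt]; exists (i, t).
Qed.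

Lemma esum_seq (T : choiceType) (s : seq T) (f : T -> \bar R) :
  uniq s -> (forall t, 0 <= f t) ->
  \esum_(t in [set` s]) f t = \sum_(t <- s) f t.
Proof. by move=> us f0; rewrite esum_fset // -fsbig_seq. Qed.

Lemma geometric_nneseries_fin (r : \bar R) : 0 <= r -> r < 1 ->
  \sum_(0 <= n <oo) r ^+ n \is a fin_num.
Proof.
case: r => [r| |] //; rewrite lee_fin lte_fin => r0 r1.
have rn_ge0 n : (0 <= n)%N -> true -> 0 <= r%:E ^+ n.
  by move=> _ _; rewrite expe_ge0 ?lee_fin.
rewrite ge0_fin_numE; last by apply: nneseries_ge0 => n; exact: rn_ge0.
apply: (@le_lt_trans _ _ ((1 - r)^-1)%:E); last exact: ltry.
apply: lime_le; first by apply: is_cvg_nneseries => n; exact: rn_ge0.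
apply: nearW => n; under eq_bigr do rewrite -EFin_expe.
rewrite sumEFin lee_fin -[leRHS]mul1r ler_pdivlMr ?subr_gt0 //.
by rewrite big_mkord mulrC -opprB mulNr -subrX1 opprB gerBl exprn_ge0.
Qed.

End Esum.

Section Weights.
Variables (R : realType) (X : finType) (C : X -> X -> R) (kappa : X -> R).
Hypothesis C_ge0 : forall x y, 0 <= C x y.
Hypothesis kappa_ge0 : forall x, 0 <= kappa x.
Local Notation P := (trans_prob C kappa).
Local Notation weight := (path_weight C kappa).
Implicit Types (x y z : X) (s t : seq X) (S : seq (seq X)).

Lemma total_rate_ge0 x : 0 <= total_rate C kappa x.
Proof. by rewrite addr_ge0 // sumr_ge0. Qed.

Lemma trans_prob_ge0 x y : 0 <= P x y.
Proof. by rewrite divr_ge0 // total_rate_ge0. Qed.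

Lemma trans_prob_gt0 x y : 0 < C x y -> 0 < P x y.
Proof.
move=> Cxy; rewrite divr_gt0 // (lt_le_trans Cxy) // /total_rate (bigD1 y) //=.
by rewrite addrCA lerDl addr_ge0 // sumr_ge0.
Qed.

Lemma sum_trans_prob x : \sum_(y : X) P x y <= 1.
Proof.
rewrite -mulr_suml; have := total_rate_ge0 x; rewrite le_eqVlt.
case/predU1P => [<-|r0]; first by rewrite invr0 mulr0 ler01.
by rewrite ler_pdivrMr // mul1r lerDr.
Qed.

Lemma path_weight_nil y : weight y [::] = 1.
Proof. exact: big_nil. Qed.

Lemma path_weight_cons y z s : weight y (z :: s) = P y z * weight z s.
Proof. by rewrite /path_weight /= big_cons. Qed.

Lemma path_weight_cat y s t :
  weight y (s ++ t) = weight y s * weight (last y s) t.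
Proof.
elim: s y => [|z s IH] y; first by rewrite path_weight_nil mul1r.
by rewrite cat_cons !path_weight_cons IH mulrA.
Qed.

Lemma path_weight_ge0 y s : 0 <= weight y s.
Proof. by apply: prodr_ge0 => a _; exact: trans_prob_ge0. Qed.

Lemma sum_path_weight_uncons y S : [::] \notin S -> \sum_(s <- S) weight y s =
  \sum_z P y z * \sum_(s <- pmap (uncons z) S) weight z s.
Proof.
elim: S => [|[|a s] S IH] // => [_|nS].
  by rewrite big_nil big1 // => z _; rewrite big_nil mulr0.
rewrite big_cons IH // (bigD1 a) //= [RHS](bigD1 a) //= eqxx big_cons mulrDr.
rewrite path_weight_cons addrA; congr (_ + _).
by apply: eq_bigr => z za; rewrite eq_sym (negbTE za).
Qed.

Lemma sum_path_weight_prefix_free y S : uniq S -> prefix_free [set` S] ->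
  \sum_(s <- S) weight y s <= 1.
Proof.
suff bounded n : forall y S, {in S, forall s, size s < n}%N -> uniq S ->
    prefix_free [set` S] -> \sum_(s <- S) weight y s <= 1.
  apply: (bounded (\max_(s <- S) size s).+1) => s sS; rewrite ltnS.
  exact: (@leq_bigmax_seq _ S xpredT size).
elim: n => [|n IH] {}y {}S sizeS uS pfS.
  by case: S sizeS {uS pfS} => [_|s S /(_ s (mem_head _ _))]; rewrite ?big_nil.
have [nilS|nilS] := boolP ([::] \in S).
  suff /perm_small_eq -> : perm_eq S [:: [::]].
  - by rewrite big_seq1 path_weight_nil.
  - by [].
  apply: uniq_perm => // s; rewrite inE; apply/idP/eqP => [sS|-> //].
  exact/esym/(pfS _ _ nilS sS)/prefix0s.
rewrite sum_path_weight_uncons //; apply: le_trans (sum_trans_prob y).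
apply: ler_sum => z _; rewrite -[leRHS]mulr1 ler_wpM2l ?trans_prob_ge0 //.
apply: IH; [|exact: uniq_pmap_uncons|exact: prefix_free_uncons].
by move=> s; rewrite mem_pmap_uncons => /sizeS.
Qed.

Lemma esum_path_weight_prefix_free_head y (Q : pred X) (A : set (seq X)) :
  prefix_free A -> ~ A [::] -> (forall s, A s -> Q (head y s)) ->
  (\esum_(s in A) (weight y s)%:E <= (\sum_(z | Q z) P y z)%:E)%E.
Proof.
move=> pfA nA QA; apply: ge_ereal_sup => _ [F [finF FA] <-].
rewrite fsbig_finite //= sumEFin lee_fin.
pose S : seq (seq X) := finmap.enum_fset (fset_set F); rewrite -/S.
have SA s : s \in S -> A s by rewrite in_fset_set // inE => /FA.
have pfS : prefix_free [set` S] by move=> s t /SA sA /SA; exact: pfA.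
rewrite sum_path_weight_uncons; last by apply/negP => /SA.
rewrite [leRHS]big_mkcond; apply: ler_sum => z _; case: ifPn => Qz.
  rewrite -[leRHS]mulr1 ler_wpM2l ?trans_prob_ge0 //.
  apply: sum_path_weight_prefix_free.
    exact/uniq_pmap_uncons/finmap.fset_uniq.
  exact: prefix_free_uncons.
rewrite big_seq big1 ?mulr0 // => s; rewrite mem_pmap_uncons => /SA/QA.
by rewrite (negbTE Qz).
Qed.

End Weights.

(** * Excursions and contours *)

Section Excursions.
Local Open Scope nat_scope.
Variables (X : finType) (E : rel X).
Implicit Types (x y z w : X) (p q c s : seq X).

(* Closed paths at [y] whose lift, started from the edge [(x, y)], stays
   strictly above [x]. *)
Definition contours x y : set (seq X) :=
  [set c | path E y c /\ lifts_above 1 [:: y; x] c [:: y; x]].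

Definition nb_returns p c : nat := count_mem p (lift_path p c).

Definition contour x y k : set (seq X) :=
  contours x y `&` [set c | nb_returns [:: y; x] c = k].

Lemma nb_returns_gt0 p c : c != [::] -> lift_end p c = p -> 0 < nb_returns p c.
Proof.
case/lastP: c => // c z _ e; rewrite /nb_returns lift_path_rcons e.
by rewrite -cats1 count_cat /= eqxx addn1.
Qed.

Lemma nb_returns_cat p c1 c2 : lift_end p c1 = p ->
  nb_returns p (c1 ++ c2) = nb_returns p c1 + nb_returns p c2.
Proof. by move=> e; rewrite /nb_returns lift_path_cat count_cat e. Qed.

Lemma nb_returns_rcons p c z : lift_end p (rcons c z) = p ->
  (nb_returns p (rcons c z) == 1) = (p \notin lift_path p c).
Proof.
move=> e; rewrite /nb_returns lift_path_rcons e -cats1 count_cat /= eqxx.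
by rewrite !addn1 eqSS; apply/eqP/count_memPn.
Qed.

Lemma first_visit p q c : q \in lift_path p c ->
  exists c1 c2, [/\ c = c1 ++ c2, lift_end p c1 = q &
                    count_mem q (lift_path p c1) = 1].
Proof.
elim: c p => //= z c IH p; rewrite inE.
case: (altP (cover_step p z =P q)) => [<-|ne].
  by move=> _; exists [:: z], c; rewrite /= eqxx.
rewrite eq_sym (negbTE ne) => /IH [c1 [c2 [-> e1 e2]]].
by exists (z :: c1), c2; rewrite /= e1 (negbTE ne) e2.
Qed.

Lemma contours_end x y c : contours x y c -> lift_end [:: y; x] c = [:: y; x].
Proof. by case=> _ /andP[/eqP]. Qed.

Lemma contours_last x y c : contours x y c -> last y c = y.
Proof.
by move=> /contours_end; have [r ->] := lift_end_head y [:: x] c => -[].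
Qed.

Lemma contours_cat x y c1 c2 : lift_end [:: y; x] c1 = [:: y; x] ->
  contours x y (c1 ++ c2) <-> contours x y c1 /\ contours x y c2.
Proof.
move=> e1; have l1 : last y c1 = y.
  by have [r] := lift_end_head y [:: x] c1; rewrite e1 => -[].
rewrite /contours /= cat_path l1 lifts_above_cat.
rewrite [lifts_above _ _ c1 _]/lifts_above e1 eqxx andTb.
by split=> [[/andP[-> ->] /andP[-> ->]]|[[-> ->] [-> ->]]].
Qed.

Lemma contour0 x y : contour x y 0 = [set [::]].
Proof.
apply/seteqP; split=> [c [/contours_end e ret0]|_ -> //]; last first.
  by split; rewrite // /contours /= lifts_above_nil.
by apply/eqP/negPn/negP => /nb_returns_gt0 /(_ e); rewrite ret0.
Qed.

Lemma contourS x y k : contour x y k.+1 =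
  (fun ab => ab.1 ++ ab.2) @` (contour x y 1 `*` contour x y k).
Proof.
apply/seteqP; split=> [c [cont ret]|_ [[a b] /= [[Ca ra] [Cb rb]] <-]];
    last first.
  have ea := contours_end Ca; split; first by apply/contours_cat.
  by rewrite /= nb_returns_cat // ra rb.
have : [:: y; x] \in lift_path [:: y; x] c.
  by rewrite -has_pred1 has_count [count _ _]ret.
move/first_visit => [c1 [c2 [ec e1 ret1]]]; exists (c1, c2); last by [].
rewrite ec in cont ret; have [C1 C2] := (contours_cat c2 e1).1 cont.
split; split=> //; move: ret.
by rewrite /= nb_returns_cat // [nb_returns _ c1]ret1 => -[].
Qed.

Lemma contour1_prefix_free x y : prefix_free (contour x y 1).
Proof.
move=> s t [Cs rs] [Ct rt] /prefixP[u et]; rewrite et in Ct rt *.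
have es := contours_end Cs.
have [_ /contours_end eu] := (contours_cat u es).1 Ct.
move: rt; rewrite /= nb_returns_cat // rs add1n => -[ru].
have [->|u0] := eqVneq u [::]; first by rewrite cats0.
by have := nb_returns_gt0 u0 eu; rewrite ru.
Qed.

Lemma first_return_translate x y c w :
  (lift_end [:: y; x] (rcons c w) == [:: y; x]) && above 2 [:: y; x] c =
  [&& head y (rcons c w) != x, lift_end [:: y] (rcons c w) == [:: y] &
      above 1 [:: y] c].
Proof.
case: c => [|z c].
  rewrite /= [[:: w; y] == _]eqseq_cons !andbF andbT.
  by case: (w == x); rewrite !eqseq_cons ?andbF.
rewrite rcons_cons !lift_end_cons !above_cons /=.
have [_|zx] := eqVneq z x; rewrite /= ?andbF //.
have zyx : [:: z; y; x] = [:: z; y] ++ [:: x] by [].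
rewrite {2}zyx (@above_cat_base _ [:: x] 1) //.
case ab: (above 1 [:: z; y] c); last by rewrite !andbF.
rewrite !andbT zyx !lift_end_rcons lift_end_cat_base //.
rewrite cover_step_cat ?(above_end _ ab) //.
exact: (@eqseq_cat2r _ [:: x] _ [:: y]).
Qed.

Lemma contour1_rcons x y c w : contour x y 1 (rcons c w) <->
  [&& path E y (rcons c w), lift_end [:: y; x] (rcons c w) == [:: y; x] &
      above 2 [:: y; x] c].
Proof.
split=> [[[pc /andP[e ab]] ret]|/and3P[pc e ab]].
  move: ab; rewrite above_rcons => /andP[ab _].
  rewrite pc e (@aboveS _ y [:: x]) //.
  by rewrite -(nb_returns_rcons (eqP e)) [nb_returns _ _]ret.
have abw : above 1 [:: y; x] (rcons c w).
  by rewrite above_rcons (eqP e) (above_le _ ab).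
split; first by split; rewrite // /lifts_above e.
apply/eqP; rewrite (nb_returns_rcons (eqP e)) -(@aboveS _ y [:: x]) //.
by move: abw; rewrite above_rcons => /andP[].
Qed.

Lemma tree_excursion_rcons x y c w : tree_excursion E x y (rcons c w) =
  [&& path E y (rcons c w), head y (rcons c w) != x,
      lift_end [:: y] (rcons c w) == [:: y] & above 1 [:: y] c].
Proof.
have liftE : cover_lift y (rcons c w) =
    rcons (lift_path [:: y] c) (lift_end [:: y] (rcons c w)).
  exact: lift_path_rcons.
have szE : size (lift_path [:: y] c) = size c by exact: size_scanl.
rewrite /tree_excursion liftE size_rcons eqSS -szE index_rcons_eq.
rewrite (@aboveS _ y [::]) ?above0 // [X in _ = [&& _, _ & X]]andbC.
by case: (c).
Qed.

Lemma tree_excursionE x y : [set s | tree_excursion E x y s] = contour x y 1.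
Proof.
apply/seteqP; split=> s; case/lastP: s => [|c w] //=.
- rewrite tree_excursion_rcons => /and4P[pc hd e ab]; apply/contour1_rcons.
  by rewrite pc first_return_translate hd e.
- by move=> [_].
- move=> /contour1_rcons; rewrite first_return_translate tree_excursion_rcons.
  by move=> /and4P[-> -> -> ->].
Qed.

End Excursions.

Section Contours.
Variables (R : realType) (X : finType) (E : rel X).
Variables (C : X -> X -> R) (kappa : X -> R).
Hypothesis C_ge0 : forall x y, 0 <= C x y.
Hypothesis kappa_ge0 : forall x, 0 <= kappa x.
Local Notation P := (trans_prob C kappa).
Local Notation weight := (path_weight C kappa).
Local Notation rho := (rho E C kappa).
Local Notation excursion_weight := (excursion_weight E C kappa).
Implicit Types (x y z : X) (p q r c s : seq X).
Local Open Scope ereal_scope.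

Let weight_ge0 y s : 0 <= (weight y s)%:E.
Proof. by rewrite lee_fin path_weight_ge0. Qed.

Lemma excursion_weight_ge0 x y : 0 <= excursion_weight x y.
Proof. by apply: esum_ge0 => s _; exact: weight_ge0. Qed.

Lemma excursion_weight_le x y :
  excursion_weight x y <= (\sum_(z | z != x) P y z)%:E.
Proof.
apply: esum_path_weight_prefix_free_head => // [|s /and4P[] //].
by rewrite tree_excursionE; exact: contour1_prefix_free.
Qed.

Lemma excursion_weight_lt1 x y : (0 < P y x)%R -> excursion_weight x y < 1.
Proof.
move=> Pyx; apply: le_lt_trans (excursion_weight_le x y) _.
rewrite lte_fin; apply: lt_le_trans (sum_trans_prob C_ge0 kappa_ge0 y).
by rewrite [ltRHS](bigD1 x) //= ltrDr.
Qed.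

Lemma excursion_weight_fin x y : excursion_weight x y \is a fin_num.
Proof.
rewrite ge0_fin_numE ?excursion_weight_ge0 //.
by apply: le_lt_trans (excursion_weight_le x y) _; rewrite ltry.
Qed.

Lemma rho_fin x y : (0 < P y x)%R -> rho x y \is a fin_num.
Proof.
move=> /excursion_weight_lt1; apply: geometric_nneseries_fin.
exact: excursion_weight_ge0.
Qed.

Lemma esum_contour x y k :
  \esum_(c in contour E x y k) (weight y c)%:E = excursion_weight x y ^+ k.
Proof.
elim: k => [|k IH].
  by rewrite contour0 esum_set1 // path_weight_nil expe0.
rewrite contourS (esum_image_mul (fa := weight y) (fb := weight y)).
- by rewrite IH expeS /excursion_weight tree_excursionE.
- by move=> a; exact: path_weight_ge0.
- by move=> a; exact: path_weight_ge0.
- exact/prefix_free_cat_inj/contour1_prefix_free.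
- by move=> a b [/contours_last la _] _; rewrite path_weight_cat la.
- by rewrite IH fin_numX ?excursion_weight_fin.
Qed.

Lemma esum_contours x y :
  \esum_(c in contours E x y) (weight y c)%:E = rho x y.
Proof.
have -> : contours E x y = \bigcup_k contour E x y k.
  apply/seteqP; split=> [c Cc|c [k _ []//]].
  by exists (nb_returns [:: y; x] c).
rewrite nneseries_sum_bigcup //.
  by apply: eq_eseriesr => k _; exact: esum_contour.
by move=> i j _ _ [c [[_ <-] [_ <-]]].
Qed.

(** * Unfolding along a reduced path *)

Definition unfolding y q : set (seq X) :=
  [set c | path E y c /\ lifts_above 1 [:: y] c q].

Lemma unfolding_last y z q c : unfolding y (z :: q) c -> last y c = z.
Proof.
by move=> [_ /andP[/eqP]]; have [r ->] := lift_end_head y [::] c => -[].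
Qed.

Lemma unfolding1 y : unfolding y [:: y] = [set [::]].
Proof.
apply/seteqP; split=> [c|_ -> //]; last by split; rewrite ?lifts_above_nil.
by case/lastP: c => // c z [_]; rewrite lifts_above_rcons andbF.
Qed.

Lemma unfoldingS y z y' r : E y' z -> reduced [:: z, y' & r] ->
  unfolding y [:: z, y' & r] = (fun ab => ab.1 ++ z :: ab.2) @`
    (unfolding y (y' :: r) `*` contours E y' z).
Proof.
move=> Eyz; rewrite reduced_cons => /andP[_ /eqP up].
apply/seteqP; split=> [c [pc]|_ [[c1 c2] /= [U1 [p2 l2]] <-]].
  move/last_exitP => [//|//|c1 [c2 [ec l1 ex]]]; exists (c1, c2) => //=.
  rewrite exit_lift // in ex; move: pc.
  rewrite ec cat_path => /andP[p1 /= /andP[_ p2]].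
  have U1 : unfolding y (y' :: r) c1 by [].
  by split.
have [p1 l1] := U1; split.
  by rewrite cat_path p1 (unfolding_last U1) /= Eyz.
by apply/last_exitP => //; exists c1, c2; rewrite exit_lift.
Qed.

Lemma unfoldingS_inj y z y' r : reduced [:: z, y' & r] ->
  set_inj (unfolding y (y' :: r) `*` contours E y' z)
          (fun ab => ab.1 ++ z :: ab.2).
Proof.
rewrite reduced_cons => /andP[_ /eqP up] [a b] [a' b'].
move=> /set_mem[/= [_ /andP[/eqP ea _]] [_]].
rewrite -(exit_lift _ up) => /andP[_ ab].
move=> /set_mem[/= [_ /andP[/eqP ea' _]] [_]].
rewrite -(exit_lift _ up) => /andP[_ ab'] e; have aa' : a = a'.
  apply: (last_exit_unique (h := size (y' :: r)) (p := [:: y]) e);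
    by rewrite ?ea ?ea'.
by move: e; rewrite aa' => /eqP; rewrite eqseq_cat // eqxx => /eqP[->].
Qed.

Lemma esum_unfoldingS y z y' r : E y' z -> (0 < P z y')%R ->
  reduced [:: z, y' & r] ->
  \esum_(s in unfolding y [:: z, y' & r]) (weight y s)%:E =
  (\esum_(s in unfolding y (y' :: r)) (weight y s)%:E) *
  ((P y' z)%:E * rho y' z).
Proof.
move=> Eyz Pzy red.
have tailE : \esum_(b in contours E y' z) (P y' z * weight z b)%:E =
    (P y' z)%:E * rho y' z.
  under eq_esum do rewrite EFinM.
  by rewrite ge0_esumZl ?trans_prob_ge0 // esum_contours.
rewrite unfoldingS // (esum_image_mul (fa := weight y)
  (fb := fun b => P y' z * weight z b)%R) ?tailE //.
- by move=> a; exact: path_weight_ge0.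
- by move=> b; rewrite mulr_ge0 ?trans_prob_ge0 ?path_weight_ge0.
- exact: unfoldingS_inj.
- move=> a b /unfolding_last la _ /=.
  by rewrite path_weight_cat path_weight_cons la.
- by rewrite fin_numM // rho_fin.
Qed.

Lemma esum_unfolding y c : (forall x z, E x z -> 0 < P z x)%R ->
  path E y c -> reduced (y :: c) ->
  \esum_(s in unfolding y (rev (y :: c))) (weight y s)%:E =
  \prod_(a <- zip (belast y c) c) ((P a.1 a.2)%:E * rho a.1 a.2).
Proof.
move=> P_gt0; elim/last_ind: c => [|c z IH].
  by rewrite unfolding1 esum_set1 // path_weight_nil big_nil.
rewrite rcons_path -rcons_cons => /andP[pc Ez] red.
have [r er] : exists r, rev (y :: c) = last y c :: r.
  by rewrite lastI rev_rcons; exists (rev (belast y c)).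
have redr : reduced [:: z, last y c & r] by rewrite -er -rev_rcons reduced_rev.
rewrite rev_rcons er esum_unfoldingS ?P_gt0 // -er IH //; last first.
  by move: red; rewrite -cats1; exact: reduced_catl.
by rewrite belast_rcons lastI zip_rcons ?size_belast // big_rcons.
Qed.

End Contours.

(** * Sums over loops *)

Section LoopSums.
Variables (R : realType) (X : finType) (E : rel X).
Implicit Types (l : loop E) (s t c : seq X).

Lemma sum_rots_undup (f : seq X -> R) t : \sum_(s <- rots t) f s =
  (count_mem t (rots t))%:R * \sum_(s <- undup (rots t)) f s.
Proof.
rewrite -big_undup_iterop_count mulr_sumr !big_seq.
apply: eq_bigr => s; rewrite mem_undup => st.
have -> : count_mem s (rots t) = count_mem t (rots t).
  have t0 : t != [::] by case: (t) st.
  by have /mem_rots-/(_ t0)[k <-] := st; rewrite count_mem_rots_rot.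
by rewrite mulr_natl.
Qed.

Lemma bigcup_rots_loop :
  \bigcup_(l in [set: loop E]) [set` undup (rots (loop_seq l))] =
  [set s | (s != [::]) && cycle E s].
Proof.
apply/seteqP; split=> [s [l _]|s sP]; rewrite /= ?mem_undup.
  by move=> /mem_rots_loop[s' <- _]; exact: valP s'.
exists (\pi_(loop E) (BasedLoop sP)); rewrite //= mem_undup.
by apply/mem_rots_loop; exists (BasedLoop sP).
Qed.

Lemma esum_based_loops (f : seq X -> R) : (forall s, 0 <= f s) ->
  (\esum_(s in [set s | (s != [::]) && cycle E s]) (f s)%:E =
   \esum_(l in [set: loop E])
     ((loop_mult l)%:R^-1 * \sum_(s <- rots (loop_seq l)) f s)%:E)%E.
Proof.
move=> f0; rewrite -bigcup_rots_loop esum_bigcup_trivIset //; last first.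
  move=> l l' _ _ [s [/=]]; rewrite !mem_undup.
  move=> /mem_rots_loop[u us <-] /mem_rots_loop[v vs <-].
  by congr \pi; apply: val_inj; rewrite us vs.
apply: eq_esum => l _; rewrite esum_seq ?undup_uniq // sumEFin sum_rots_undup.
by rewrite -loop_multE mulKf // pnatr_eq0 -lt0n loop_mult_gt0.
Qed.

Variables (C : X -> X -> R) (kappa : X -> R).
Hypothesis E_irr : irreflexive E.
Hypothesis C_ge0 : forall x y, 0 <= C x y.
Hypothesis kappa_ge0 : forall x, 0 <= kappa x.
Implicit Types (g : geodesic_loop E).
Local Notation P := (trans_prob C kappa).

Definition cyclic_weight s : R := \prod_(a <- zip s (rot 1 s)) P a.1 a.2.

Lemma cyclic_weight_ge0 s : 0 <= cyclic_weight s.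
Proof. by apply: prodr_ge0 => a _; exact: trans_prob_ge0. Qed.

Lemma cyclic_weight_rot i s : cyclic_weight (rot i s) = cyclic_weight s.
Proof.
rewrite /cyclic_weight rot_rot zip_rot ?size_rot //.
by apply: perm_big; rewrite perm_rot.
Qed.

Lemma cyclic_weight_cons y s :
  cyclic_weight (y :: s) = path_weight C kappa y (rcons s y).
Proof. by rewrite /cyclic_weight /path_weight rot1_cons belast_rcons. Qed.

Lemma sum_rots_unfolds q t :
  \sum_(s <- rots t) (unfolds q s)%:R * cyclic_weight s =
  (nb_unfolds q t)%:R * cyclic_weight t.
Proof.
rewrite /nb_unfolds -sum1_count natr_sum mulr_suml [RHS]big_mkcond /=.
rewrite !big_seq; apply: eq_bigr => s st.
have t0 : t != [::] by case: (t) st.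
have /mem_rots-/(_ t0)[k <-] := st; rewrite cyclic_weight_rot.
by case: (unfolds _ _); rewrite ?mul0r.
Qed.

Local Open Scope ereal_scope.

Lemma esum_loop_measure g :
  \esum_(l in [set l | loop_geodesic l = Some g]) (loop_measure C kappa l)%:E =
  ((loop_mult (val g))%:R^-1)%:E *
  \esum_(s in [set s | unfolds (geodesic_end g) s /\ cycle E s])
    (cyclic_weight s)%:E.
Proof.
set q := geodesic_end g; set m := (loop_mult (val g))%:R.
pose f s : R := ((unfolds q s)%:R * cyclic_weight s)%R.
have f0 s : (0 <= f s)%R by rewrite mulr_ge0 ?ler0n ?cyclic_weight_ge0.
have -> : [set s | unfolds q s /\ cycle E s] =
    [set s | (s != [::]) && cycle E s] `&` [set` unfolds q].
  by apply/seteqP; split=> [[|x s] []|s [/andP[]]].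
rewrite esum_mkcondr (eq_esum (b := fun s => (f s)%:E)); last first.
  move=> s _; rewrite mem_setE -[s \in _]/(unfolds q s) /f.
  by case: (unfolds q s); rewrite ?mul1r ?mul0r.
rewrite esum_based_loops // -ge0_esumZl ?invr_ge0 ?ler0n //; last first.
  by move=> l; rewrite lee_fin mulr_ge0 ?invr_ge0 ?ler0n // sumr_ge0.
rewrite esum_mkcond; apply: eq_esum => l _.
have -> : (l \in [set l | loop_geodesic l = Some g]) =
    (loop_geodesic l == Some g).
  by apply/idP/eqP; rewrite inE.
rewrite sum_rots_unfolds nb_unfoldsE // -EFinM; case: eqP => _; last first.
  by rewrite mul0r !mulr0.
by rewrite [in RHS]mulrCA mulKf // /m pnatr_eq0 -lt0n loop_mult_gt0.
Qed.

Lemma unfolding_rot1 y t : unfolding E y (closed_end (y :: t)) =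
  rot 1 @` [set s | unfolds (closed_end (y :: t)) s /\ cycle E s].
Proof.
apply/seteqP; split=> [c [pc lc]|_ [[[]//|z s] [uz cz] <-]].
  case/lastP: c pc lc => [|c w] pc lc.
    move: lc; rewrite lifts_above_nil => /eqP/(congr1 size).
    by rewrite /= size_rev.
  have wy : w = y.
    move: lc => /andP[/eqP].
    by have [r ->] := lift_end_rcons_head [:: y] c w => -[].
  by rewrite wy in pc lc *; exists (y :: c); [split | exact: rot1_cons].
have zy : z = y.
  have /andP[/eqP] := uz; have [r] := lift_end_bottom [::] z (rcons s z).
  rewrite [rcons [::] z]/= => ->; rewrite /= rev_cons -rcons_cons.
  by move=> /rcons_inj[].
by rewrite rot1_cons zy in uz cz *.
Qed.

Lemma esum_cyclic_weight y t (q := closed_end (y :: t)) :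
  \esum_(s in [set s | unfolds q s /\ cycle E s]) (cyclic_weight s)%:E =
  \esum_(c in unfolding E y q) (path_weight C kappa y c)%:E.
Proof.
rewrite unfolding_rot1 esum_image; last by move=> s s' _ _ /rot_inj.
apply: eq_esum => -[|z s] [//] uz cz.
have : (unfolding E y q) (rot 1 (z :: s)).
  by rewrite unfolding_rot1; exists (z :: s).
rewrite cyclic_weight_cons rot1_cons => -[_ /andP[/eqP]].
by have [r ->] := lift_end_rcons_head [:: y] s z => -[->].
Qed.

Hypothesis P_gt0 : forall x z, E x z -> (0 < P z x)%R.

Lemma esum_unfolds_geodesic g :
  \esum_(s in [set s | unfolds (geodesic_end g) s /\ cycle E s])
    (cyclic_weight s)%:E =
  \prod_(a <- loop_edges (val g)) ((P a.1 a.2)%:E * rho E C kappa a.1 a.2).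
Proof.
have := valP g; rewrite /geodesic -/(geodesic_seq _) /loop_edges /geodesic_end.
have := loop_size_gt1 (val g) E_irr; have /andP[_] := loop_seqP (val g).
case: (loop_seq (val g)) => [//|y s] cg s1 /(geodesic_reduced s1) red.
have -> : zip (y :: s) (rot 1 (y :: s)) =
    zip (belast y (rcons s y)) (rcons s y).
  by rewrite rot1_cons belast_rcons.
rewrite esum_cyclic_weight -esum_unfolding //.
by rewrite -rcons_cons rev_rcons.
Qed.

Lemma loop_edgesP l a : a \in loop_edges l -> E a.1 a.2.
Proof.
rewrite /loop_edges; have /andP[_] := loop_seqP l.
case: (loop_seq l) => // y s; rewrite rot1_cons /cycle -(belast_rcons y s y).
move: (rcons s y) => c; elim: c y => //= z c IH y /andP[Eyz pc].
by rewrite inE => /predU1P[->|/(IH _ pc)].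
Qed.

Lemma geodesic_mean_fin g : geodesic_mean C kappa (val g) \is a fin_num.
Proof.
rewrite /geodesic_mean fin_numM // big_seq prode_fin_num // => a.
move=> /loop_edgesP Ea.
by rewrite fin_numM // rho_fin // P_gt0.
Qed.

End LoopSums.

Lemma poisson_point_process_independent (d : measure_display)
    (Omega : measurableType d) (R : realType) (Pr : probability Omega R)
    (I T : choiceType) (mu : T -> R) (N : T -> Omega -> nat) (A : I -> set T) :
  poisson_point_process Pr mu N -> trivIset [set: I] A ->
  independent_variables Pr (fun i => point_count N (A i)).
Proof.
move=> [_ _ indep] tA; split=> [i|s B us mB].
  have [|meas _] := indep 1%N (fun=> A i); last exact: (meas ord0).
  by move=> j k _ _ _; rewrite [j]ord1 [k]ord1.
pose t := tnth (in_tuple s); have t_inj : injective t by apply/tuple_uniqP.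
have [|_ /(_ (index_enum 'I_(size s)) (fun j => B (t j)))] :=
    indep (size s) (fun j => A (t j)).
  by move=> j k _ _ jk; apply/t_inj/tA.
move=> /(_ (index_enum_uniq _) (fun j => mB (t j))).
rewrite (big_tnth _ _ s) => <-; congr (Pr _).
apply/seteqP; split=> w Bw i /= si; first by apply: Bw; exact: mem_tnth.
by have [j ->] := tnthP (in_tuple s) i si; apply: Bw; exact: mem_index_enum.
Qed.

Theorem proposition5
  (d : measure_display) (Omega : measurableType d) (R : realType)
  (Pr : probability Omega R)
  (X : finType) (E : rel X)
  (E_sym : symmetric E) (E_irr : irreflexive E)
  (E_conn : forall x y : X, connect E x y)
  (C : X -> X -> R) (kappa : X -> R)
  (C_sym : forall x y : X, C x y = C y x)
  (C_gt0 : forall x y : X, E x y -> 0 < C x y)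
  (C_eq0 : forall x y : X, ~~ E x y -> C x y = 0)
  (kappa_ge0 : forall x : X, 0 <= kappa x)
  (L : loop E -> Omega -> nat)
  (L_ppp : poisson_point_process Pr (loop_measure (E := E) C kappa) L) :
  let N (g : geodesic_loop E) : Omega -> \bar R :=
    point_count L [set l : loop E | loop_geodesic l = Some g] in
  independent_variables Pr N /\
  forall g : geodesic_loop E,
    (geodesic_mean C kappa (val g) < +oo)%E /\
    poisson_variable Pr (N g) (geodesic_mean C kappa (val g)).
Proof.
have C_ge0 x y : 0 <= C x y.
  by case: (boolP (E x y)) => [/C_gt0/ltW //|/C_eq0 ->].
have P_gt0 x z : E x z -> 0 < trans_prob C kappa z x.
  by rewrite E_sym => /C_gt0; exact: trans_prob_gt0.
move=> N; split.
  apply: (poisson_point_process_independent L_ppp).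
  by move=> g g' _ _ [l [/= -> [->]]].
move=> g; split.
  have := geodesic_mean_fin C_ge0 kappa_ge0 P_gt0 g.
  by rewrite fin_numElt => /andP[].
have [_ /(_ [set l : loop E | loop_geodesic l = Some g]) poisson_N _] := L_ppp.
by rewrite esum_loop_measure // esum_unfolds_geodesic // in poisson_N.
Qed.
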